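(* Suppose the LP $\min_{x\ge0}c^\top x$ s.t. $Ax=b$ is infeasible (primal or dual infeasible), let $0<\eta\le\frac1{2\|A\|_2}$, let $v$ be the infimal displacement vector of the PDHG operator $T$, and let $\mathcal Z_v^*=\{z: T(z)-z-v=0\}$. Let $0<C\le\min\left\{\frac1{\sqrt2(1+\eta\|A\|_2)},\frac{\eta}{\sqrt2(1+\eta\|A\|_2)}\right\}$. Then there exists $\tilde z_0^*\in\mathcal Z_v^*$, belonging also to $\mathrm{Fix}(\widetilde T)\cap\{z:x_{N_2}=0\}$, such that, with $$R=2(\|z^{0,0}-\tilde z_0^*\|_2+\|\tilde z_0^*\|_2),$$ with $\alpha_\eta$ the sharpness constant associated with $\tilde z_0^*$ (see context), and with $$k^*=\left\lceil\max\left\{\frac{12R}{C\delta_v},\ \frac{(\sqrt2+1)e}{\alpha_\eta}\log\left(\frac{(\sqrt2+1)e}{\alpha_\eta}\right)\right\}\right\rceil ,$$ the iterates $\{z^{n,0}\}$ of restarted Halpern PDHG with fixed restart frequency, where each inner loop is terminated as soon as $k\ge k^*$, satisfy for every $n\ge0$ $$\|T(z^{n,0})-z^{n,0}-v\|\le 2e^{-n}\,\mathrm{dist}(z^{0,0},\mathcal Z_v^* ).$$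
   Context: Let $A\in\mathbb R^{m\times d}$ be nonzero with columns $A_i$, $b\in\mathbb R^m$, $c\in\mathbb R^d$; write $z=(x,y)\in\mathbb R^{d+m}$. The LP has primal-dual form $\min_{x\ge 0}\max_{y} c^\top x+y^\top Ax-b^\top y$. $\|\cdot\|_2$ is the Euclidean norm for vectors and the spectral norm for matrices. For an index set $S$, $x_S$ is the subvector and $A_S$ the submatrix of columns indexed by $S$. The PDHG operator $T(x,y)=(x^+,y^+)$ is $$x^+=\mathrm{proj}_{\mathbb R^d_+}(x-\eta A^\top y-\eta c),\qquad y^+=y+\eta A(2x^+-x)-\eta b.$$ Let $P_\eta=\begin{pmatrix}\frac1\eta I&-A^\top\\-A&\frac1\eta I\end{pmatrix}$, $\|z\|=\sqrt{\langle z,P_\eta z\rangle}$ and $\mathrm{dist}(z,\mathcal U)=\inf_{u\in\mathcal U}\|z-u\|$. The infimal displacement vector $v=(v_x,v_y)$ is the unique element of minimum norm $\|\cdot\|$ in $\mathrm{Range}(T-I)$ (which is closed and convex). Restarted Halpern PDHG: start from $z^{0,0}$. In outer loop $n=0,1,2,\dots$, for inner counter $k=0,1,\dots$ set $$z^{n,k+1}=\frac{k+1}{k+2}T(z^{n,k})+\frac1{k+2}z^{n,0}$$ until the restart condition holds at the current $k$; then set $z^{n+1,0}=T(z^{n,k})$ with this $k$ and start outer loop $n+1$. Index sets: $B=\{i:(v_x)_i>0\}$, $N_1=\{i:(v_x)_i=0,\ A_i^\top v_y=0\}$, $N_2=\{i:(v_x)_i=0,\ A_i^\top v_y>0\}$.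 Closeness to degeneracy: $\delta_v=\min\{\min_{i\in B}(v_x)_i,\ \min_{i\in N_2}A_i^\top v_y/\|A\|_2\}$ (a minimum over the empty set is $+\infty$). Auxiliary operator: $\widetilde T(x,y)=(x^+,y^+)$ with $$x_B^+=x_B-\eta A_B^\top y-\eta c_B-(v_x)_B,$$ $$x_{N_j}^+=\mathrm{proj}_{\mathbb R_+^{|N_j|}}(x_{N_j}-\eta A_{N_j}^\top y-\eta c_{N_j})-(v_x)_{N_j}\quad(j=1,2),$$ $$y^+=y+\eta A(2x^+-x)-\eta b-v_y .$$ It is the PDHG operator of the feasible and bounded auxiliary LP: minimize $(c_B+(v_x)_B/\eta)^\top x_B+c_{N_1}^\top x_{N_1}+c_{N_2}^\top x_{N_2}$ subject to $Ax=b+v_y/\eta$, $x_{N_1}\ge0$, $x_{N_2}\ge0$. $\mathrm{Fix}(\widetilde T)$ is its set of fixed points. Sharpness constant associated with $\tilde z_0^*$: $\alpha_\eta\in(0,1)$ (of the form $\frac{\eta\alpha}{\eta\alpha+2}$ with $\alpha>0$) is a constant such that $$\alpha_\eta\,\mathrm{dist}\big(z,\mathrm{Fix}(\widetilde T)\cap\{z:x_{N_2}=0\}\big)\le\|\widetilde T(z)-z\|$$ for every $z=(x,y)$ with $x_{N_2}=0$ and $\|z\|_2\le 2(\|z^{0,0}-\tilde z_0^*\|_2+\|\tilde z_0^*\|_2)$ (such a constant exists). *)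

(* Defs.v *)
From mathcomp Require Import all_boot all_order all_algebra.
From mathcomp Require Import boolp classical_sets reals constructive_ereal.
From mathcomp Require Import sequences exp.
Set Implicit Arguments.
Unset Strict Implicit.
Unset Printing Implicit Defensive.
Import Order.TTheory GRing.Theory Num.Theory.
Local Open Scope classical_set_scope.
Local Open Scope ring_scope.

Definition norm2 (R : realType) (n : nat) (x : 'cV[R]_n) : R :=
  Num.sqrt (\sum_(i < n) x i 0 ^+ 2).

Definition spectral_norm (R : realType) (m d : nat) (A : 'M[R]_(m, d)) : R :=
  sup [set norm2 (A *m x) | x in [set x : 'cV[R]_d | norm2 x <= 1]].

(* The dual constraint is the one attached to the saddle-point form
   min_{x >= 0} max_y c^T x + y^T A x - b^T y, hence its sign. *)
Definition primal_feasible (R : realType) (m d : nat) (A : 'M[R]_(m, d))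
    (b : 'cV[R]_m) : Prop :=
  exists x : 'cV[R]_d, (forall i, 0 <= x i 0) /\ A *m x = b.

Definition dual_feasible (R : realType) (m d : nat) (A : 'M[R]_(m, d))
    (c : 'cV[R]_d) : Prop :=
  exists y : 'cV[R]_m, forall i, 0 <= (c + A^T *m y) i 0.

Definition lp_infeasible (R : realType) (m d : nat) (A : 'M[R]_(m, d))
    (b : 'cV[R]_m) (c : 'cV[R]_d) : Prop :=
  ~ primal_feasible A b \/ ~ dual_feasible A c.

Definition proj_nonneg (R : realType) (n : nat) (x : 'cV[R]_n) : 'cV[R]_n :=
  \col_i Num.max 0 (x i 0).

(* A primal-dual pair z = (x, y) is the stacked column col_mx x y, so that
   x = usubmx z and y = dsubmx z. *)
Definition pdhg (R : realType) (m d : nat) (A : 'M[R]_(m, d))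
    (b : 'cV[R]_m) (c : 'cV[R]_d) (eta : R) (z : 'cV[R]_(d + m)) :
    'cV[R]_(d + m) :=
  let x := usubmx z in
  let y := dsubmx z in
  let x' := proj_nonneg (x - eta *: (A^T *m y) - eta *: c) in
  let y' := y + eta *: (A *m (2 *: x' - x)) - eta *: b in
  col_mx x' y'.

Definition Pmx (R : realType) (m d : nat) (A : 'M[R]_(m, d)) (eta : R) :
    'M[R]_(d + m) :=
  block_mx (eta^-1%:M) (- A^T) (- A) (eta^-1%:M).

Definition normP (R : realType) (m d : nat) (A : 'M[R]_(m, d)) (eta : R)
    (z : 'cV[R]_(d + m)) : R :=
  Num.sqrt ((z^T *m (Pmx A eta *m z)) 0 0).

Definition distP (R : realType) (m d : nat) (A : 'M[R]_(m, d)) (eta : R)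
    (z : 'cV[R]_(d + m)) (U : set 'cV[R]_(d + m)) : R :=
  inf [set normP A eta (z - u) | u in U].

Definition is_inf_displacement (R : realType) (m d : nat) (A : 'M[R]_(m, d))
    (b : 'cV[R]_m) (c : 'cV[R]_d) (eta : R) (v : 'cV[R]_(d + m)) : Prop :=
  let D := range (fun z => pdhg A b c eta z - z) in
  D v /\ forall u, D u -> normP A eta v <= normP A eta u.

Definition Zstar (R : realType) (m d : nat) (A : 'M[R]_(m, d))
    (b : 'cV[R]_m) (c : 'cV[R]_d) (eta : R) (v : 'cV[R]_(d + m)) :
    set 'cV[R]_(d + m) :=
  [set z | pdhg A b c eta z - z - v = 0].

Definition idxB (R : realType) (m d : nat) (v : 'cV[R]_(d + m)) : {set 'I_d} :=
  [set i | 0 < usubmx v i 0]%SET.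

Definition idxN1 (R : realType) (m d : nat) (A : 'M[R]_(m, d))
    (v : 'cV[R]_(d + m)) : {set 'I_d} :=
  [set i | (usubmx v i 0 == 0) && ((A^T *m dsubmx v) i 0 == 0)]%SET.

Definition idxN2 (R : realType) (m d : nat) (A : 'M[R]_(m, d))
    (v : 'cV[R]_(d + m)) : {set 'I_d} :=
  [set i | (usubmx v i 0 == 0) && (0 < (A^T *m dsubmx v) i 0)]%SET.

(* Extended-real valued: equal to +oo when B and N2 are both empty. *)
Definition delta (R : realType) (m d : nat) (A : 'M[R]_(m, d))
    (v : 'cV[R]_(d + m)) : \bar R :=
  mine (\big[mine/+oo%E]_(i in idxB v) (usubmx v i 0)%:E)
       (\big[mine/+oo%E]_(i in idxN2 A v)
          ((A^T *m dsubmx v) i 0 / spectral_norm A)%:E).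

(* For the infimal displacement vector v, the sets B, N1 and N2 partition the
   indices; the last branch, for an index in none of them, is then never
   used. *)
Definition pdhg_aux (R : realType) (m d : nat) (A : 'M[R]_(m, d))
    (b : 'cV[R]_m) (c : 'cV[R]_d) (eta : R) (v z : 'cV[R]_(d + m)) :
    'cV[R]_(d + m) :=
  let x := usubmx z in
  let y := dsubmx z in
  let u := x - eta *: (A^T *m y) - eta *: c in
  let x' := \col_i
    (if i \in idxB v then u i 0 - usubmx v i 0
     else if i \in idxN1 A v :|: idxN2 A v then
       proj_nonneg u i 0 - usubmx v i 0
     else 0) in
  let y' := y + eta *: (A *m (2 *: x' - x)) - eta *: b - dsubmx v in
  col_mx x' y'.

Definition zeroN2 (R : realType) (m d : nat) (A : 'M[R]_(m, d))
    (v : 'cV[R]_(d + m)) : set 'cV[R]_(d + m) :=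
  [set z | forall i, i \in idxN2 A v -> usubmx z i 0 = 0].

Definition FixN2 (R : realType) (m d : nat) (A : 'M[R]_(m, d))
    (b : 'cV[R]_m) (c : 'cV[R]_d) (eta : R) (v : 'cV[R]_(d + m)) :
    set 'cV[R]_(d + m) :=
  [set z | pdhg_aux A b c eta v z = z] `&` zeroN2 A v.

Definition radius (R : realType) (n : nat) (z0 zt : 'cV[R]_n) : R :=
  2 * (norm2 (z0 - zt) + norm2 zt).

Definition is_sharpness_constant (R : realType) (m d : nat)
    (A : 'M[R]_(m, d)) (b : 'cV[R]_m) (c : 'cV[R]_d) (eta : R)
    (v z0 zt : 'cV[R]_(d + m)) (a : R) : Prop :=
  [/\ 0 < a < 1,
      exists2 alpha : R, 0 < alpha & a = eta * alpha / (eta * alpha + 2) &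
      forall z, zeroN2 A v z -> norm2 z <= radius z0 zt ->
        a * distP A eta z (FixN2 A b c eta v)
          <= normP A eta (pdhg_aux A b c eta v z - z)].

Fixpoint halpern (R : realType) (n : nat) (T : 'cV[R]_n -> 'cV[R]_n)
    (z0 : 'cV[R]_n) (k : nat) : 'cV[R]_n :=
  if k is k'.+1 then
    (k'.+1%:R / k'.+2%:R) *: T (halpern T z0 k') + k'.+2%:R^-1 *: z0
  else z0.

(* The starting points z^{n,0}.  With the restart test k >= K, the inner
   counter, which goes through 0, 1, 2, ... , first passes the test at k = K. *)
Fixpoint restarted_halpern (R : realType) (p : nat)
    (T : 'cV[R]_p -> 'cV[R]_p) (K : nat) (z0 : 'cV[R]_p) (n : nat) :
    'cV[R]_p :=
  if n is n'.+1 then T (halpern T (restarted_halpern T K z0 n') K) else z0.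

(* The first term of the max is 0 when del = +oo.  The ceiling is that of a
   positive real when 0 < a < 1, so taking its absolute value only converts it
   to nat. *)
Definition kstar (R : realType) (rad C : R) (del : \bar R) (a : R) : nat :=
  let s := (Num.sqrt 2 + 1) * expR 1 / a in
  let t := Num.max (fine ((12 * rad)%:E / (C%:E * del))%E) (s * ln s) in
  `|Num.ceil t|%N.

(* Main.v *)
Require Import Defs.
From mathcomp Require Import all_boot all_order all_algebra.
From mathcomp Require Import boolp classical_sets reals constructive_ereal.
From mathcomp Require Import sequences exp.
From mathcomp Require Import ring lra.
Set Implicit Arguments.
Unset Strict Implicit.
Unset Printing Implicit Defensive.
Import Order.TTheory GRing.Theory Num.Theory.
Local Open Scope classical_set_scope.
Local Open Scope ring_scope.

(* T is firmly nonexpansive for the inner product P, and minimality of v gives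
   T (z + t v) = z + (t + 1) v for z in Z*_v and t >= 0.  Hence v_x >= 0,
   A v_x = 0, and A_i^T v_y is 0 on B and >= 0 elsewhere, so T commutes with
   the translation by t v at every z whose forward step
   x - eta A^T y - eta c is >= 0 on B and <= 0 on N_2; at such z the auxiliary
   operator is T - v.  The Halpern iterates stay at bounded distance from the
   ray z* + (k/2) v, hence are eventually of this kind.  From there on the
   potential k(k+1)/2 |F z^k|^2 + (k+1) <F z^k, z^k - (k/2) v - z^0>, with
   F z = z - T z + v, is nonincreasing and yields an O(1/k) rate; with
   sharpness every later epoch divides the distance to
   Fix (T~) /\ {x_N2 = 0} by e.
   Since the centre may be any zt = z* + t v, it is taken far enough along v
   for the radius to be as large as needed.  Then k* a_eta is so large that the
   O(1/k) bound, with whatever constant the initial transient produces, already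
   gives the factor 2/e after the first epoch.  When B and N_2 are empty there
   is no transient. *)

(** * Halpern iteration of a firmly nonexpansive map with drift *)

(** Kept abstract so that it covers both the Euclidean product and the product of [Pmx]. *)
Definition inner_product (R : realType) (p : nat)
    (f : 'cV[R]_p -> 'cV[R]_p -> R) : Prop :=
  [/\ forall x y, f x y = f y x,
      forall a x y z, f (a *: x + y) z = a * f x z + f y z &
      forall x, x != 0 -> 0 < f x x].

Section InnerProduct.
Variables (R : realType) (p : nat) (f : 'cV[R]_p -> 'cV[R]_p -> R).
Hypothesis f_inner : inner_product f.

Definition ipnorm (x : 'cV[R]_p) : R := Num.sqrt (f x x).

Lemma ipC x y : f x y = f y x.
Proof. by case: f_inner. Qed.

Lemma ip0l z : f 0 z = 0.
Proof.
case: f_inner => _ H _; have := H 1 0 0 z.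
by rewrite scaler0 addr0 mul1r => /eqP; rewrite -subr_eq subrr eq_sym => /eqP.
Qed.

Lemma ipDl x y z : f (x + y) z = f x z + f y z.
Proof. by case: f_inner => _ H _; have := H 1 x y z; rewrite scale1r mul1r. Qed.

Lemma ipZl a x z : f (a *: x) z = a * f x z.
Proof. by case: f_inner => _ H _; have := H a x 0 z; rewrite addr0 ip0l addr0. Qed.

Lemma ipNl x z : f (- x) z = - f x z.
Proof. by rewrite -scaleN1r ipZl mulN1r. Qed.

Lemma ipDr x y z : f z (x + y) = f z x + f z y.
Proof. by rewrite ![f z _]ipC ipDl. Qed.

Lemma ipZr a x z : f z (a *: x) = a * f z x.
Proof. by rewrite ![f z _]ipC ipZl. Qed.

Lemma ipNr x z : f z (- x) = - f z x.
Proof. by rewrite ![f z _]ipC ipNl. Qed.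

Definition ipE := (ipDl, ipDr, ipNl, ipNr, ipZl, ipZr).

Lemma ip_ge0 x : 0 <= f x x.
Proof.
have [->|x0] := eqVneq x 0; first by rewrite ip0l.
by case: f_inner => _ _ H; apply/ltW/H.
Qed.

Lemma ipnorm_ge0 x : 0 <= ipnorm x.
Proof. exact: sqrtr_ge0. Qed.

Lemma ipnorm_sqr x : ipnorm x ^+ 2 = f x x.
Proof. by rewrite sqr_sqrtr ?ip_ge0. Qed.

Lemma ipnorm_eq0 x : ipnorm x = 0 -> x = 0.
Proof.
move=> h; apply/eqP; apply: contraT => x0.
case: f_inner => _ _ /(_ _ x0).
by rewrite -ipnorm_sqr h expr0n ltxx.
Qed.

Lemma ler_ipnorm x y : (ipnorm x <= ipnorm y) = (f x x <= f y y).
Proof. by rewrite ler_sqrt ?ip_ge0. Qed.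

Lemma ipnormN x : ipnorm (- x) = ipnorm x.
Proof. by rewrite /ipnorm ipNl ipNr opprK. Qed.

Lemma ipnormZ a x : 0 <= a -> ipnorm (a *: x) = a * ipnorm x.
Proof.
by move=> a0; rewrite /ipnorm ipZl ipZr mulrA sqrtrM ?mulr_ge0 // -expr2 sqrtr_sqr ger0_norm.
Qed.

Lemma ip_cauchy_schwarz x y : f x y <= ipnorm x * ipnorm y.
Proof.
have [/eqP a0|a0] := boolP (ipnorm x == 0).
  by rewrite (ipnorm_eq0 a0) ip0l -(ipnorm_eq0 a0) a0 mul0r.
have [/eqP b0|b0] := boolP (ipnorm y == 0).
  by rewrite (ipnorm_eq0 b0) ipC ip0l -(ipnorm_eq0 b0) b0 mulr0.
have ab : 0 < ipnorm x * ipnorm y by rewrite mulr_gt0 // lt_def ipnorm_ge0 ?a0 ?b0.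
have := ip_ge0 (ipnorm y *: x - ipnorm x *: y).
rewrite !ipE (ipC y x) -!ipnorm_sqr => h.
rewrite -subr_ge0 -(pmulr_rge0 _ ab); nra.
Qed.

Lemma ipnorm_triangle x y : ipnorm (x + y) <= ipnorm x + ipnorm y.
Proof.
rewrite -(@ler_pXn2r _ 2) ?nnegrE ?addr_ge0 ?ipnorm_ge0 //.
rewrite ipnorm_sqr !ipE (ipC y x) -!ipnorm_sqr.
have := ip_cauchy_schwarz x y; nra.
Qed.

End InnerProduct.

Section Halpern.
Variables (R : realType) (p : nat) (f : 'cV[R]_p -> 'cV[R]_p -> R).
Hypothesis f_inner : inner_product f.
Variables (T : 'cV[R]_p -> 'cV[R]_p) (v : 'cV[R]_p).
Hypothesis T_firm : forall z w, f (T z - T w) (T z - T w) <= f (T z - T w) (z - w).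
Local Notation nrm := (ipnorm f).
Local Notation ipE := (ipE f_inner).

(** This sign makes the residual cocoercive; its zeros are the points of Z*_v. *)
Definition resid (z : 'cV[R]_p) : 'cV[R]_p := z - T z + v.

Lemma firm_nonexpansive z w : nrm (T z - T w) <= nrm (z - w).
Proof.
rewrite ler_ipnorm //; have := T_firm z w.
have := ip_ge0 f_inner ((z - w) - (T z - T w)).
move: (T z - T w) (z - w) => a b.
rewrite !ipE (ipC f_inner b a); lra.
Qed.

(** Firmness is symmetric under replacing a map by the identity minus that map, and [v] cancels in
    differences. *)
Lemma resid_cocoercive z w :
  f (resid z - resid w) (resid z - resid w) <= f (resid z - resid w) (z - w).
Proof.
have := T_firm z w.
have -> : resid z - resid w = (z - w) - (T z - T w).
  by apply/matrixP => i j; rewrite !mxE; ring.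
move: (T z - T w) (z - w) => a b.
rewrite !ipE (ipC f_inner b a); lra.
Qed.

Lemma resid_le z w : nrm (resid z - resid w) <= nrm (z - w).
Proof.
rewrite ler_ipnorm //; have := resid_cocoercive z w.
have := ip_ge0 f_inner ((z - w) - (resid z - resid w)).
move: (resid z - resid w) (z - w) => a b.
rewrite !ipE (ipC f_inner b a); lra.
Qed.

(* With u = T (z + v) - (z + v), firmness at (z + v, z) reads
   |u|^2 + |u - v|^2 <= |v|^2, while |v| <= |u|. *)
Lemma min_displacement_translate z :
  (forall u, nrm v <= nrm (T u - u)) -> T z = z + v -> T (z + v) = z + v + v.
Proof.
move=> hmin hz.
have [u E] : exists u, T (z + v) = z + v + u.
  by exists (T (z + v) - (z + v)); rewrite [z + v + _]addrC subrK.
have := T_firm (z + v) z; have := hmin (z + v).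
have sub (x y : 'cV[R]_p) : x + y - x = y by rewrite [_ - x]addrC addKr.
rewrite ler_ipnorm // E hz !sub => h1 h2.
suff: u - v = 0 by move/eqP; rewrite subr_eq0 => /eqP ->.
apply: (ipnorm_eq0 f_inner); apply/eqP; rewrite sqrtr_eq0.
rewrite !ipE (ipC f_inner v u); lra.
Qed.

Variable zs : 'cV[R]_p.
Hypothesis zs_drift : forall t, 0 <= t -> T (zs + t *: v) = zs + (t + 1) *: v.

(** Started at [zs], the Halpern iterates are exactly [zs + (k/2) v], since (k+1)/(k+2) (k/2 + 1) =
    (k+1)/2; nonexpansiveness and the convex combination preserve the initial distance to them. *)
Lemma halpern_near_drift z k :
  nrm (halpern T z k - (zs + (k%:R / 2) *: v)) <= nrm (z - zs).
Proof.
elim: k => [|k IHk]; first by rewrite mul0r scale0r addr0.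
have kE : k.+1%:R = k%:R + 1 :> R by rewrite -natr1.
have kE2 : k.+2%:R = k%:R + 2 :> R by rewrite -2!natr1; ring.
have k0 : 0 <= k%:R :> R by [].
rewrite /=; set y := halpern T z k in IHk *.
have -> : (k.+1%:R / k.+2%:R) *: T y + k.+2%:R^-1 *: z - (zs + (k.+1%:R / 2) *: v)
  = (k.+1%:R / k.+2%:R) *: (T y - T (zs + (k%:R / 2) *: v)) + k.+2%:R^-1 *: (z - zs).
  rewrite zs_drift ?divr_ge0 // kE kE2.
  apply/matrixP => i j; rewrite !mxE; field; lra.
apply: le_trans (ipnorm_triangle f_inner _ _) _.
rewrite !ipnormZ ?divr_ge0 ?invr_ge0 //.
have H := le_trans (firm_nonexpansive y (zs + (k%:R / 2) *: v)) IHk.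
have E : k.+1%:R / k.+2%:R * nrm (z - zs) + k.+2%:R^-1 * nrm (z - zs) = nrm (z - zs).
  rewrite kE kE2; field; lra.
rewrite -[leRHS]E.
by rewrite lerD2r ler_wpM2l ?divr_ge0.
Qed.

End Halpern.

(** * The Halpern potential and its O(1/k) rate in the presence of a drift *)

Section Drift.
Variables (R : realType) (p : nat) (f : 'cV[R]_p -> 'cV[R]_p -> R).
Hypothesis f_inner : inner_product f.
Variables (T : 'cV[R]_p -> 'cV[R]_p) (v : 'cV[R]_p).
Hypothesis T_firm : forall z w, f (T z - T w) (T z - T w) <= f (T z - T w) (z - w).
Local Notation nrm := (ipnorm f).
Local Notation ipE := (ipE f_inner).
Local Notation F := (resid T v).

(** An epoch advances the comparison point by K/2 through the inner loop and by 1 through the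
    closing application of [T]. *)
Lemma restarted_near_drift zs K z n :
  (forall t, 0 <= t -> T (zs + t *: v) = zs + (t + 1) *: v) ->
  nrm (restarted_halpern T K z n - (zs + (n%:R * (K%:R / 2 + 1)) *: v))
    <= nrm (z - zs).
Proof.
move=> drift; elim: n => [|n IHn]; first by rewrite mul0r scale0r addr0.
set s := n%:R * (K%:R / 2 + 1) in IHn.
have s0 : 0 <= s by rewrite mulr_ge0 ?addr_ge0 ?divr_ge0.
have drift' t : 0 <= t -> T ((zs + s *: v) + t *: v) = (zs + s *: v) + (t + 1) *: v.
  by move=> t0; rewrite -!addrA -!scalerDl drift ?addr_ge0 // addrA.
apply: le_trans IHn; rewrite /=.
have -> : zs + (n.+1%:R * (K%:R / 2 + 1)) *: v = T ((zs + s *: v) + (K%:R / 2) *: v).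
  rewrite drift' ?divr_ge0 // -addrA -scalerDl; congr (_ + _ *: _).
  by rewrite /s -natr1; ring.
apply: le_trans (firm_nonexpansive f_inner T_firm _ _) _.
exact: halpern_near_drift.
Qed.

(** The Halpern Lyapunov function of the recentred iterate [y - (k/2) v]; it vanishes at k = 0. *)
Definition potential (z : 'cV[R]_p) (k : nat) : R :=
  let y := halpern T z k in
  k%:R * (k%:R + 1) / 2 * f (F y) (F y) +
  (k%:R + 1) * f (F y) (y - (k%:R / 2) *: v - z).

(** Cocoercivity is used between the next iterate and [y + v/2]: the half step makes up for the
    growth of k/2, and by the translation hypothesis it leaves the residual unchanged. *)
Lemma potential_step z k :
  (forall t, 0 <= t -> T (halpern T z k + t *: v) = T (halpern T z k) + t *: v) ->
  potential z k.+1 <= potential z k.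
Proof.
move=> trans; rewrite /potential /=; set y := halpern T z k in trans *.
have kE : k.+1%:R = k%:R + 1 :> R by rewrite -natr1.
have kE2 : k.+2%:R = k%:R + 2 :> R by rewrite -2!natr1; ring.
have k0 : 0 <= k%:R :> R by [].
set y' := (_ *: T y + _); set h := F y'; set g := F y.
set a := y - (k%:R / 2) *: v - z.
have Fy : F (y + 2^-1 *: v) = g.
  by rewrite /g /resid trans ?invr_ge0 //; apply/matrixP => i j; rewrite !mxE; ring.
have := resid_cocoercive f_inner v T_firm y' (y + 2^-1 *: v); rewrite Fy -/h.
have -> : y' - (k.+1%:R / 2) *: v - z = ((k%:R + 1) / (k%:R + 2)) *: (a - g).
  rewrite /y' /a /g /resid kE kE2; apply/matrixP => i j; rewrite !mxE; field; lra.
have -> : y' - (y + 2^-1 *: v) = ((k%:R + 1) / (k%:R + 2)) *: (a - g) - a.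
  rewrite /y' /a /g /resid kE kE2; apply/matrixP => i j; rewrite !mxE; field; lra.
have := ip_ge0 f_inner (h - g).
clearbody h g a; rewrite kE; move: (k%:R : R) k0 => r r0 h1 h2.
rewrite -subr_ge0.
(* The decrease is (k+1)(k+2) times the sum of the slack in cocoercivity and half of |h - g|^2. *)
have -> : r * (r + 1) / 2 * f g g + (r + 1) * f g a -
    ((r + 1) * (r + 1 + 1) / 2 * f h h +
     (r + 1 + 1) * f h (((r + 1) / (r + 2)) *: (a - g))) =
    (r + 1) * (r + 2) * ((f (h - g) (((r + 1) / (r + 2)) *: (a - g) - a)
       - f (h - g) (h - g)) + f (h - g) (h - g) / 2).
  rewrite !ipE (ipC f_inner g h); field; lra.
by apply: mulr_ge0; [nra | rewrite addr_ge0 ?subr_ge0 ?divr_ge0].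
Qed.

(** Monotonicity at the drifted reference point bounds the cross term of the potential below by
    -(k+1) <F y, z - w>, which Cauchy-Schwarz controls. *)
Lemma potential_bound z w k :
  0 <= f (F (halpern T z k)) (halpern T z k - (w + (k%:R / 2) *: v)) ->
  k%:R * (k%:R + 1) / 2 * nrm (F (halpern T z k)) ^+ 2 <=
    potential z k + (k%:R + 1) * (nrm (F (halpern T z k)) * nrm (z - w)).
Proof.
rewrite /potential; set y := halpern T z k; set g := F y => h.
have k0 : 0 <= k%:R + 1 :> R by rewrite addr_ge0.
have := ler_wpM2l k0 (ip_cauchy_schwarz f_inner g (z - w)).
have := mulr_ge0 k0 h.
have -> : y - (w + (k%:R / 2) *: v) = (y - (k%:R / 2) *: v - z) + (z - w).
  by apply/matrixP => i j; rewrite !mxE; ring.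
rewrite (ipnorm_sqr f_inner) (ipDr f_inner); lra.
Qed.

(* The last summand is absent for M = 0, which makes the rate sharp enough for
   contraction in the epochs without a transient. *)
Lemma halpern_rate (z w : 'cV[R]_p) k M : (0 < k)%N -> 0 <= M ->
  potential z k <= M ->
  0 <= f (F (halpern T z k)) (halpern T z k - (w + (k%:R / 2) *: v)) ->
  k%:R * nrm (F (halpern T z k)) <= 2 * nrm (z - w) + (2 * M + (M != 0)%:R).
Proof.
move=> k0 M0 hM /potential_bound.
have k1 : 1 <= k%:R :> R by rewrite ler1n.
have := ipnorm_ge0 f (z - w); have := ipnorm_ge0 f (F (halpern T z k)).
move: (nrm (F _)) (nrm (z - w)) (potential z k) hM (k%:R : R) k1
  => g r V hM x x1 g0 r0 h.
(* Cancelling k + 1 leaves a quadratic inequality in k |F y|. *)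
have h1 : (x * g) ^+ 2 <= 2 * M + 2 * r * (x * g).
  have h2 : (x + 1) * (x * g ^+ 2 / 2) <= (x + 1) * (M / x + r * g).
    apply: (@le_trans _ _ (V + (x + 1) * (r * g))); first by lra.
    rewrite mulrDr lerD2r mulrCA (le_trans hM) // ler_peMr //.
    by rewrite ler_pdivlMr; lra.
  have {}h2 : x * g ^+ 2 / 2 <= M / x + r * g by rewrite ler_pM2l in h2; lra.
  have -> : 2 * M + 2 * r * (x * g) = 2 * x * (M / x + r * g) by field; lra.
  have -> : (x * g) ^+ 2 = 2 * x * (x * g ^+ 2 / 2) by field.
  by apply: ler_wpM2l h2; lra.
have xg : 0 <= x * g by apply: mulr_ge0; lra.
move: (x * g) xg h1 => y y0 h1.
have [Mn0|Mn0] := eqVneq M 0 => /=.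
  move: h1; rewrite Mn0 !mulr0 !addr0 => h1.
  rewrite add0r in h1; rewrite leNgt; apply/negP => h2; nra.
(* If y exceeded 2 r + 2 M + 1, then y > 1 would give y (y - 2 r) > 2 M. *)
rewrite leNgt; apply/negP => h2; nra.
Qed.

End Drift.

(** * The P-norm *)

Section Dot.
Variable R : realType.

Definition dot (n : nat) (x y : 'cV[R]_n) : R := (x^T *m y) 0 0.

Lemma dotE n (x y : 'cV[R]_n) : dot x y = \sum_i x i 0 * y i 0.
Proof. by rewrite /dot mxE; apply: eq_bigr => i _; rewrite mxE. Qed.

Lemma dot_inner n : inner_product (@dot n).
Proof.
split=> [x y|a x y z|x x0].
- by rewrite !dotE; apply: eq_bigr => i _; rewrite mulrC.
- by rewrite /dot linearP mulmxDl -scalemxAl !mxE.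
- rewrite dotE lt_def sumr_ge0 ?andbT => [|i _]; last exact: sqr_ge0.
  apply: contra x0; rewrite psumr_eq0 => [|i _]; last exact: sqr_ge0.
  move=> /allP h; apply/eqP/matrixP => i j; rewrite (ord1 j) mxE.
  by have := h i; rewrite mem_index_enum mulf_eq0 orbb => /(_ isT)/eqP.
Qed.

Lemma norm2E n (x : 'cV[R]_n) : norm2 x = ipnorm (@dot n) x.
Proof. by rewrite /ipnorm dotE. Qed.

Lemma norm2_ge0 n (x : 'cV[R]_n) : 0 <= norm2 x.
Proof. exact: sqrtr_ge0. Qed.

Lemma dot_trmx m n (A : 'M[R]_(m, n)) (x : 'cV[R]_n) (y : 'cV[R]_m) :
  dot x (A^T *m y) = dot (A *m x) y.
Proof. by rewrite /dot trmx_mul mulmxA. Qed.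

Lemma ler_abs_norm2 n (x : 'cV[R]_n) i : `|x i 0| <= norm2 x.
Proof.
rewrite -sqrtr_sqr ler_sqrt ?sumr_ge0 // => [|j _]; last exact: sqr_ge0.
by rewrite (bigD1 i) //= lerDl sumr_ge0 // => j _; exact: sqr_ge0.
Qed.

(** Needed for the supremum in [spectral_norm] to be a genuine upper bound; row-wise Cauchy-Schwarz
    gives the Frobenius norm as a bound. *)
Lemma spectral_norm_bounded m n (A : 'M[R]_(m, n)) :
  has_ubound [set norm2 (A *m x) | x in [set x : 'cV[R]_n | norm2 x <= 1]].
Proof.
exists (Num.sqrt (\sum_i dot (row i A)^T (row i A)^T)) => _ [x /= x1 <-].
rewrite ler_sqrt; last by apply: sumr_ge0 => i _; apply: (ip_ge0 (dot_inner n)).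
apply: ler_sum => i _.
have -> : (A *m x) i 0 = dot (row i A)^T x.
  by rewrite /dot trmxK -row_mul !mxE.
rewrite -(ipnorm_sqr (dot_inner n)) -real_normK ?num_real //.
rewrite ler_pXn2r ?nnegrE // ?sqrtr_ge0 //.
have H (w : 'cV[R]_n) : dot w x <= norm2 w.
  apply: le_trans (ip_cauchy_schwarz (dot_inner n) _ _) _.
  by rewrite -!norm2E ler_piMr // norm2_ge0.
rewrite ler_norml -norm2E H lerNl andbT.
rewrite -(ipNl (dot_inner n)) (le_trans (H _)) //.
by rewrite !norm2E ipnormN //; apply: dot_inner.
Qed.

Lemma norm2_mulmx m n (A : 'M[R]_(m, n)) (x : 'cV[R]_n) :
  norm2 (A *m x) <= spectral_norm A * norm2 x.
Proof.
have [x0|x0] := eqVneq (norm2 x) 0.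
  have -> : x = 0 by apply: (ipnorm_eq0 (dot_inner n)); rewrite -norm2E.
  by rewrite mulmx0 !norm2E /ipnorm !(ip0l (dot_inner _)) sqrtr0 mulr0.
have x_gt0 : 0 < norm2 x by rewrite lt_def x0 norm2_ge0.
have xi : 0 <= (norm2 x)^-1 by rewrite invr_ge0 norm2_ge0.
have := ub_le_sup (spectral_norm_bounded A).
move=> /(_ (norm2 (A *m ((norm2 x)^-1 *: x)))); rewrite -/(spectral_norm A).
rewrite -scalemxAr [norm2 (_ *: (A *m x))]norm2E (ipnormZ (dot_inner _)) //.
rewrite -norm2E mulrC -ler_pdivrMr //; apply.
exists ((norm2 x)^-1 *: x).
  by rewrite /= norm2E (ipnormZ (dot_inner _)) // -norm2E mulVf.
by rewrite -scalemxAr norm2E (ipnormZ (dot_inner _)) // -norm2E mulrC.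
Qed.

End Dot.

Arguments dot_inner {R n}.

Section InnerP.
Variables (R : realType) (m d : nat) (A : 'M[R]_(m, d)) (eta : R).
Hypotheses (eta_gt0 : 0 < eta) (eta_le : eta <= 1 / (2 * spectral_norm A)).

Definition dotP (z w : 'cV[R]_(d + m)) : R := (z^T *m (Pmx A eta *m w)) 0 0.

Lemma normPE z : normP A eta z = ipnorm dotP z.
Proof. by []. Qed.

Lemma dotPE z w :
  dotP z w = eta^-1 * (dot (usubmx z) (usubmx w) + dot (dsubmx z) (dsubmx w))
    - dot (A *m usubmx z) (dsubmx w) - dot (dsubmx z) (A *m usubmx w).
Proof.
rewrite -dot_trmx -{1}[z]vsubmxK -{1}[w]vsubmxK /dotP /Pmx tr_col_mx mul_block_col mul_row_col.
rewrite !mul_scalar_mx !mulmxDr !mulNmx !mulmxN -!scalemxAr !mxE /dot !mxE; ring.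
Qed.

(** With 1 / 0 = 0, the step-size bound and [0 < eta] exclude a zero norm. *)
Lemma spectral_norm_gt0 : 0 < spectral_norm A.
Proof.
have := lt_le_trans eta_gt0 eta_le.
by rewrite div1r invr_gt0 pmulr_rgt0.
Qed.

(** As |A| <= 1/(2 eta), the cross term 2 <A x, y> is at most |x| |y| / eta, hence at most half of
    |z|^2 / eta. *)
Lemma dotP_coercive z : (2 * eta)^-1 * dot z z <= dotP z z.
Proof.
have zE : dot z z = norm2 (usubmx z) ^+ 2 + norm2 (dsubmx z) ^+ 2.
  rewrite !norm2E !(ipnorm_sqr dot_inner) !dotE big_split_ord.
  by congr (_ + _); apply: eq_bigr => i _; rewrite !mxE.
rewrite dotPE zE (ipC dot_inner (dsubmx z) (A *m _)).
have := ip_cauchy_schwarz dot_inner (A *m usubmx z) (dsubmx z).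
rewrite -!norm2E => h1.
have h2 := ler_wpM2r (norm2_ge0 (dsubmx z)) (norm2_mulmx A (usubmx z)).
rewrite -!(ipnorm_sqr dot_inner) -!norm2E.
have h3 : spectral_norm A <= (2 * eta)^-1.
  rewrite -lef_pV2 ?posrE ?invr_gt0 ?mulr_gt0 ?spectral_norm_gt0 // invrK.
  by move: eta_le; rewrite div1r invfM -ler_pdivlMl // mulrC.
have := norm2_ge0 (usubmx z); have := norm2_ge0 (dsubmx z).
have -> : eta^-1 = 2 * (2 * eta)^-1 by field; rewrite gt_eqF.
have s0 := spectral_norm_gt0.
move: (norm2 (usubmx z)) (norm2 (dsubmx z)) (dot _ _) h1 h2 => x y D h1 h2 y0 x0.
move: (spectral_norm A) ((2 * eta)^-1) h3 s0 h2 => s e h3 s0 h2.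
have h4 := ler_wpM2r (mulr_ge0 x0 y0) h3.
have h5 := mulr_ge0 (ltW (lt_le_trans s0 h3)) (sqr_ge0 (x - y)).
lra.
Qed.

Lemma dotP_inner : inner_product dotP.
Proof.
split=> [x y|a x y z|x x0].
- rewrite !dotPE ![dot (usubmx x) (usubmx y)](ipC dot_inner).
  rewrite ![dot (dsubmx x) (dsubmx y)](ipC dot_inner).
  by rewrite ![dot (A *m _) _](ipC dot_inner) addrAC.
- by rewrite /dotP linearP mulmxDl -scalemxAl !mxE.
- apply: lt_le_trans (dotP_coercive x); rewrite mulr_gt0 ?invr_gt0 ?mulr_gt0 //.
  by case: (@dot_inner R (d + m)) => _ _; apply.
Qed.

Lemma norm2_le_normP z : norm2 z <= Num.sqrt (2 * eta) * normP A eta z.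
Proof.
rewrite normPE norm2E /ipnorm -sqrtrM; last by rewrite mulr_ge0 // ltW.
rewrite ler_sqrt; last first.
  by rewrite !mulr_ge0 ?(ltW eta_gt0) ?(ip_ge0 dotP_inner).
by rewrite -ler_pdivrMl ?mulr_gt0 //; apply: dotP_coercive.
Qed.

End InnerP.

(** * PDHG and its drift *)

Section Eventually.
Variable R : realType.

Lemma exists_nat_affine_gt (a b M : R) : 0 < b ->
  exists n0 : nat, forall n, (n0 <= n)%N -> M < a + n%:R * b.
Proof.
move=> b0; set B := Num.bound `|(M - a) / b|; exists B => n hn.
rewrite -ltrBlDl -ltr_pdivrMr // (@lt_le_trans _ _ B%:R) ?ler_nat //.
apply: le_lt_trans (ler_norm _) _; exact: archi_boundP.
Qed.

(** One primal coordinate along the orbit z + n v: [a] and [b] are the forward step and its slope,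
    [x] and [w] the entries of z and v. If w > 0, two affine functions agree for large n; if w = 0,
    boundedness excludes b > 0, and b < 0 makes the maximum eventually 0. *)
Lemma max0_arith_prog (a b x w : R) :
  (forall n : nat, Num.max 0 (a + n%:R * b) = x + (n%:R + 1) * w) ->
  [/\ 0 <= w, 0 < w -> b = w /\ a = x + w &
      w = 0 -> [/\ b <= 0, 0 <= x & b < 0 -> x = 0]].
Proof.
move=> h.
have w0 : 0 <= w.
  rewrite leNgt; apply/negP => w_lt0.
  have [|n0 /(_ _ (leqnn _)) hn] := @exists_nat_affine_gt (- x - w) (- w) 0.
    by rewrite oppr_gt0.
  have := h n0; have : 0 <= Num.max 0 (a + n0%:R * b) by rewrite le_max lexx.
  lra.
split=> // [w_gt0|w_eq0].
  have [n0 hn] := @exists_nat_affine_gt (x + w) w 0 w_gt0.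
  have hm n : (n0 <= n)%N -> a + n%:R * b = x + (n%:R + 1) * w.
    move=> /hn hgt; have := h n; rewrite /Num.max.
    by case: ifP => _ // E; lra.
  have := hm n0 (leqnn _); have := hm n0.+1 (leqnSn _); rewrite -natr1.
  move=> h1 h2; have bw : b = w by lra.
  by split=> //; move: h2; rewrite bw; lra.
have {}h n : Num.max 0 (a + n%:R * b) = x by rewrite h w_eq0 mulr0 addr0.
have x0 : 0 <= x by rewrite -(h 0%N) le_max lexx.
split=> // [|b0].
  rewrite leNgt; apply/negP => b0.
  have [n0 /(_ _ (leqnn _))] := @exists_nat_affine_gt a b x b0.
  by rewrite -{1}(h n0) gt_max ltxx andbF.
have [|n0 /(_ _ (leqnn _)) hn] := @exists_nat_affine_gt (- a) (- b) 0.
  by rewrite oppr_gt0.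
by rewrite -(h n0); apply/max_idPl; lra.
Qed.

Lemma eventually_forall_ord d (P : 'I_d -> R -> Prop) :
  (forall i, exists2 s0, 0 <= s0 & forall s, s0 <= s -> P i s) ->
  exists2 s0, 0 <= s0 & forall s, s0 <= s -> forall i, P i s.
Proof.
move=> h.
have /choice[s0 hs] : forall i, exists s0, 0 <= s0 /\ forall s, s0 <= s -> P i s.
  by move=> i; have [s] := h i; exists s.
have s0_ge0 i : 0 <= s0 i by case: (hs i).
(* The sum of nonnegative thresholds dominates each of them. *)
exists (\sum_i s0 i) => [|s hge i]; first exact: sumr_ge0.
case: (hs i) => _; apply; apply: le_trans hge.
by rewrite (bigD1 i) //= lerDl sumr_ge0.
Qed.

Lemma eventually_affine_ge0 (a b : R) : 0 < b ->
  exists2 s0, 0 <= s0 & forall s, s0 <= s -> 0 <= a + s * b.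
Proof.
move=> b0; exists (`|a| / b) => [|s]; first by rewrite divr_ge0 // ltW.
by rewrite ler_pdivrMr // => hs; have := ler_norm (- a); rewrite normrN; lra.
Qed.

End Eventually.

Section Submx.
Variables (R : realType) (m n : nat).
Implicit Types z w : 'cV[R]_(m + n).

Lemma usubmxD z w : usubmx (z + w) = usubmx z + usubmx w.
Proof. exact: linearD. Qed.

Lemma dsubmxD z w : dsubmx (z + w) = dsubmx z + dsubmx w.
Proof. exact: linearD. Qed.

Lemma usubmxZ a z : usubmx (a *: z) = a *: usubmx z.
Proof. exact: linearZ. Qed.

Lemma dsubmxZ a z : dsubmx (a *: z) = a *: dsubmx z.
Proof. exact: linearZ. Qed.

Lemma usubmxB z w : usubmx (z - w) = usubmx z - usubmx w.
Proof. exact: linearB. Qed.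

Lemma dsubmxB z w : dsubmx (z - w) = dsubmx z - dsubmx w.
Proof. exact: linearB. Qed.

End Submx.

(** * PDHG as a firmly nonexpansive map in the P-norm *)

Section LP.
Variables (R : realType) (m d : nat) (A : 'M[R]_(m, d)) (b : 'cV[R]_m)
  (c : 'cV[R]_d) (eta : R) (v : 'cV[R]_(d + m)).
Hypothesis eta_gt0 : 0 < eta.
Local Notation T := (pdhg A b c eta).
Local Notation vx := (usubmx v).
Local Notation vy := (dsubmx v).
Local Notation idxB := (idxB v).
Local Notation idxN1 := (idxN1 A v).
Local Notation idxN2 := (idxN2 A v).

(** The linear part of the forward step: [primal_grad v] is the rate at which [primal_step] changes
    along v. *)
Definition primal_grad (z : 'cV[R]_(d + m)) : 'cV[R]_d :=
  usubmx z - eta *: (A^T *m dsubmx z).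

Definition primal_step (z : 'cV[R]_(d + m)) : 'cV[R]_d := primal_grad z - eta *: c.

(** The new primal point is an argument so that [pdhg] and [pdhg_aux] share this map. *)
Definition dual_step (z : 'cV[R]_(d + m)) (x' : 'cV[R]_d) : 'cV[R]_m :=
  dsubmx z + eta *: (A *m (2 *: x' - usubmx z)) - eta *: b.

Lemma pdhgE z :
  T z = col_mx (proj_nonneg (primal_step z)) (dual_step z (proj_nonneg (primal_step z))).
Proof. by []. Qed.

Lemma primal_stepD z w : primal_step (z + w) = primal_step z + primal_grad w.
Proof.
rewrite /primal_step /primal_grad usubmxD dsubmxD mulmxDr.
by apply/matrixP => i j; rewrite !mxE; ring.
Qed.

Lemma primal_gradZ t w : primal_grad (t *: w) = t *: primal_grad w.
Proof.
rewrite /primal_grad usubmxZ dsubmxZ -scalemxAr.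
by apply/matrixP => i j; rewrite !mxE; ring.
Qed.

Lemma primal_gradE i : primal_grad v i 0 = vx i 0 - eta * (A^T *m vy) i 0.
Proof. by rewrite !mxE. Qed.

(** In the P-product the dual update cancels, and the slack becomes 1/eta times that of the
    Euclidean projection onto the orthant, which is nonnegative in each coordinate. *)
Lemma pdhg_firm z w : dotP A eta (T z - T w) (T z - T w) <= dotP A eta (T z - T w) (z - w).
Proof.
rewrite !pdhgE; set x1 := proj_nonneg _; set x2 := proj_nonneg (_ w).
rewrite opp_col_mx add_col_mx.
set q := col_mx _ _.
rewrite -subr_ge0.
have -> : dotP A eta q (z - w) - dotP A eta q q = dotP A eta q ((z - w) - q).
  rewrite /dotP !mulmxBr !mxE; ring.
suff -> : dotP A eta q ((z - w) - q) =
    eta^-1 * dot (x1 - x2) (primal_step z - primal_step w - (x1 - x2)).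
  apply: mulr_ge0; first by rewrite invr_ge0 ltW.
  rewrite dotE; apply: sumr_ge0 => i _; rewrite /x1 /x2.
  move: (primal_step z) (primal_step w) => s1 s2; rewrite !mxE.
  by rewrite /Num.max; case: ltP => h1; case: ltP => h2; nra.
set e := x1 - x2; set dx := usubmx (z - w); set dy := dsubmx (z - w).
have -> : primal_step z - primal_step w = dx - eta *: (A^T *m dy).
  rewrite /primal_step /primal_grad /dx /dy usubmxB dsubmxB mulmxBr.
  by apply/matrixP => i j; rewrite !mxE; ring.
have qE : q = col_mx e (dy + eta *: (A *m (2 *: e - dx))).
  rewrite /q /dual_step -/e; congr col_mx.
  rewrite /dy /dx /e usubmxB dsubmxB !mulmxBr -!scalemxAr !mulmxBr.
  by apply/matrixP => i j; rewrite !mxE; ring.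
have {qE} [qu qd] : usubmx q = e /\ dsubmx q = dy + eta *: (A *m (2 *: e - dx)).
  by rewrite qE col_mxKu col_mxKd.
have ru : usubmx (z - w - q) = dx - e by rewrite usubmxB qu.
have rd : dsubmx (z - w - q) = - (eta *: (A *m (2 *: e - dx))).
  by rewrite dsubmxB qd -/dy opprD addNKr.
rewrite dotPE qu qd ru rd; clearbody e dx dy.
rewrite !mulmxBr -!scalemxAr !(ipE dot_inner) dot_trmx.
rewrite !(ipC dot_inner dy) (ipC dot_inner (A *m dx) (A *m e)).
by field; rewrite gt_eqF.
Qed.

End LP.

(** * Index structure of v, and the region where T commutes with translations along v *)

Section DriftStructure.
Variables (R : realType) (m d : nat) (A : 'M[R]_(m, d)) (b : 'cV[R]_m)
  (c : 'cV[R]_d) (eta : R) (v : 'cV[R]_(d + m)).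
Hypothesis eta_gt0 : 0 < eta.
Local Notation T := (pdhg A b c eta).
Local Notation vx := (usubmx v).
Local Notation vy := (dsubmx v).
Local Notation step := (primal_step A c eta).
Local Notation grad := (primal_grad A eta).

(** All that the translation lemmas use about v; these conditions make B, N_1 and N_2 a
    partition. *)
Definition drift_conditions : Prop :=
  [/\ A *m vx = 0, forall i, 0 <= vx i 0,
      forall i, 0 < vx i 0 -> (A^T *m vy) i 0 = 0 &
      forall i, vx i 0 = 0 -> 0 <= (A^T *m vy) i 0].

(** The region where the projection is the identity on B and zero on N_2. N_1 is left free because
    the forward step does not change there along v. *)
Definition active (z : 'cV[R]_(d + m)) : Prop :=
  forall i, (i \in idxB v -> 0 <= step z i 0) /\ (i \in idxN2 A v -> step z i 0 <= 0).

Lemma drift_orbit_structure z :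
  (forall n : nat, T (z + n%:R *: v) = z + (n%:R + 1) *: v) ->
  drift_conditions /\
  [/\ forall i, 0 < vx i 0 -> step z i 0 = usubmx z i 0 + vx i 0 &
      forall i, vx i 0 = 0 -> 0 < (A^T *m vy) i 0 -> usubmx z i 0 = 0].
Proof.
move=> hz.
have hx i (n : nat) : Num.max 0 (step z i 0 + n%:R * grad v i 0) =
    usubmx z i 0 + (n%:R + 1) * vx i 0.
  have := congr1 usubmx (hz n); rewrite pdhgE col_mxKu primal_stepD primal_gradZ.
  rewrite usubmxD usubmxZ => /matrixP /(_ i 0).
  by rewrite /proj_nonneg !mxE.
have hy (n : nat) : eta *: (A *m usubmx z) + (n%:R + 2) *: (eta *: (A *m vx)) - eta *: b = vy.
  have := congr1 dsubmx (hz n); rewrite pdhgE col_mxKd /dual_step.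
  have -> : proj_nonneg (step (z + n%:R *: v)) = usubmx z + (n%:R + 1) *: vx.
    by have := congr1 usubmx (hz n); rewrite pdhgE col_mxKu usubmxD usubmxZ.
  rewrite !usubmxD !dsubmxD !usubmxZ !dsubmxZ !(mulmxDr, mulmxN, =^~ scalemxAr).
  move: (A *m usubmx z) (A *m vx) => p q E.
  apply/matrixP => i j; move/matrixP/(_ i j): E; rewrite !mxE.
  set y0 := dsubmx z i j; set v0 := vy i j; lra.
(* Only the term with [A v_x] depends on n in [hy], so n = 0 and n = 1 suffice. *)
have Av : A *m vx = 0.
  have E : eta *: (A *m vx) = 0.
    have := hy 1%N; rewrite -{1}(hy 0%N) => /matrixP E.
    by apply/matrixP => i j; have := E i j; rewrite !mxE; lra.
  by apply/eqP; move/eqP: E; rewrite scaler_eq0 gt_eqF.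
split; first split=> // i.
- by case: (max0_arith_prog (hx i)).
- move=> vi; case: (max0_arith_prog (hx i)) => _ /(_ vi)[E _] _.
  move: E; rewrite primal_gradE => /eqP; rewrite -subr_eq0 addrAC subrr add0r.
  by rewrite oppr_eq0 mulf_eq0 gt_eqF //= => /eqP.
- move=> vi; case: (max0_arith_prog (hx i)) => _ _ /(_ vi)[E _ _].
  by move: E; rewrite primal_gradE vi sub0r oppr_le0 pmulr_rge0.
split=> i vi.
  by case: (max0_arith_prog (hx i)) => _ /(_ vi)[].
move=> Av_gt0; case: (max0_arith_prog (hx i)) => _ _ /(_ vi)[_ _]; apply.
by rewrite primal_gradE vi sub0r oppr_lt0 mulr_gt0.
Qed.

Hypothesis v_drift : drift_conditions.

Let Avx0 : A *m vx = 0. Proof. by case: v_drift. Qed.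

Lemma drift_index_cases i :
  [\/ i \in idxB v /\ grad v i 0 = vx i 0,
      i \notin idxB v /\ i \in idxN1 A v /\ vx i 0 = 0 /\ grad v i 0 = 0 |
      i \notin idxB v /\ i \in idxN2 A v /\ vx i 0 = 0 /\ grad v i 0 < 0].
Proof.
case: v_drift => _ hv hB hN.
rewrite !inE primal_gradE; have := hv i; rewrite le_eqVlt eq_sym => /orP[/eqP v0|vi].
  have := hN i v0; rewrite v0 eqxx ltxx /= le_eqVlt eq_sym => /orP[/eqP h|h].
    by constructor 2; rewrite h eqxx mulr0 subr0.
  by constructor 3; rewrite h sub0r oppr_lt0 mulr_gt0.
by constructor 1; rewrite vi (hB i vi) mulr0 subr0.
Qed.

Lemma idxB_notin_N2 i : i \in idxB v -> i \in idxN2 A v = false.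
Proof. by rewrite !inE => h; rewrite gt_eqF. Qed.

(** Along v the forward step grows on B and decreases on N_2, so neither sign can be lost. *)
Lemma activeD z t : active z -> 0 <= t -> active (z + t *: v).
Proof.
move=> hz t0 i; case: (hz i) => hB hN2.
have -> : step (z + t *: v) i 0 = step z i 0 + t * grad v i 0.
  by rewrite primal_stepD primal_gradZ !mxE.
have hv : 0 <= vx i 0 by case: v_drift.
case: (drift_index_cases i) => [[iB ->]|[/negbTE iB [iN1 [v0 ->]]]|[/negbTE iB [iN2 [v0 g]]]].
- by rewrite iB (idxB_notin_N2 iB); split=> // _; rewrite addr_ge0 ?hB ?mulr_ge0.
- by rewrite iB mulr0 addr0; split.
- rewrite iB iN2; split=> // _; have := hN2 iN2.
  have : t * grad v i 0 <= 0 by rewrite mulr_ge0_le0 // ltW.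
  lra.
Qed.

Lemma dual_stepD z x' t :
  dual_step A b eta (z + t *: v) (x' + t *: vx) = dual_step A b eta z x' + t *: vy.
Proof.
rewrite /dual_step usubmxD dsubmxD usubmxZ dsubmxZ.
rewrite !(mulmxDr, mulmxN, =^~ scalemxAr) Avx0 !scaler0 !addr0.
move: (A *m x') (A *m usubmx z) => p q.
by apply/matrixP => i j; rewrite !mxE; ring.
Qed.

Lemma col_mx_drift t : col_mx (t *: vx) (t *: vy) = t *: v.
Proof. by rewrite -scale_col_mx vsubmxK. Qed.

(** On B the projection is inactive and the slope is v_x; on N_1 slope and v_x vanish; on N_2 both
    projections are 0. The dual part follows from [A v_x = 0]. *)
Lemma pdhg_translate z t : active z -> 0 <= t -> T (z + t *: v) = T z + t *: v.
Proof.
move=> hz t0; rewrite !pdhgE.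
have E : proj_nonneg (step (z + t *: v)) = proj_nonneg (step z) + t *: vx.
  apply/matrixP => i j; rewrite (ord1 j) {j}.
  have := activeD hz t0 i; have := hz i.
  rewrite primal_stepD primal_gradZ.
  move: (step z) (grad v) (drift_index_cases i) => s g; rewrite /proj_nonneg !mxE.
  move=> h [hB hN2] [hB' hN2'].
  case: h => [[iB gi]|[_ [_ [-> ->]]]|[_ [iN2 [-> gi]]]].
  - move: (hB iB) (hB' iB) => /max_idPr -> /max_idPr ->; by rewrite gi.
  - by rewrite !mulr0 !addr0.
  - by move: (hN2 iN2) (hN2' iN2) => /max_idPl -> /max_idPl ->; rewrite mulr0 addr0.
by rewrite E dual_stepD -col_mx_drift add_col_mx.
Qed.

Definition primal_aux (z : 'cV[R]_(d + m)) : 'cV[R]_d :=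
  \col_i (if i \in idxB v then step z i 0 - vx i 0
          else if i \in idxN1 A v :|: idxN2 A v then proj_nonneg (step z) i 0 - vx i 0
          else 0).

Lemma pdhg_auxE z :
  pdhg_aux A b c eta v z = col_mx (primal_aux z) (dual_step A b eta z (primal_aux z) - vy).
Proof. by []. Qed.

Lemma primal_auxE z i :
  primal_aux z i 0 = if i \in idxB v then step z i 0 - vx i 0
                     else Num.max 0 (step z i 0).
Proof.
rewrite /primal_aux mxE finset.in_setU; move: (step z) => s; rewrite /proj_nonneg.
case: (drift_index_cases i) => [[-> _] //|[/negbTE -> [-> [-> _]]]|[/negbTE -> [-> [-> _]]]].
  by rewrite /= mxE subr0.
by rewrite orbT mxE subr0.
Qed.

(** The projection that T~ omits on B has no effect at an active point, and subtracting v_x from the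
    new primal point does not affect the dual step, as [A v_x = 0]. *)
Lemma pdhg_aux_active z : active z -> pdhg_aux A b c eta v z = T z - v.
Proof.
move=> hz; rewrite pdhg_auxE pdhgE.
have E : primal_aux z = proj_nonneg (step z) - vx.
  apply/matrixP => i j; rewrite (ord1 j) {j} primal_auxE.
  have := hz i; move: (step z) (drift_index_cases i) => s; rewrite /proj_nonneg !mxE.
  move=> h [hB hN2].
  case: h => [[iB gi]|[/negbTE -> [_ [-> _]]]|[/negbTE -> [_ [-> _]]]]; rewrite ?subr0 //.
  by rewrite iB; move/max_idPr: (hB iB) => ->.
rewrite E.
have -> : dual_step A b eta z (proj_nonneg (step z) - vx) = dual_step A b eta z (proj_nonneg (step z)).
  rewrite /dual_step; congr (_ + eta *: _ - _).
  by rewrite scalerBr !mulmxBr -!scalemxAr Avx0 scaler0 subr0.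
by rewrite -{3}[v]vsubmxK opp_col_mx add_col_mx.
Qed.

(** Brings restart points, which are images under T, into the domain of the sharpness inequality. *)
Lemma zeroN2_pdhg z : active z -> zeroN2 A v (T z).
Proof.
move=> hz i iN2; rewrite pdhgE col_mxKu mxE; apply/max_idPl.
by case: (hz i) => _; apply.
Qed.

Lemma zeroN2D z t : zeroN2 A v z -> zeroN2 A v (z + t *: v).
Proof.
move=> hz i iN2; move: (iN2); rewrite inE => /andP[/eqP vi _].
by rewrite usubmxD usubmxZ; move: (hz i iN2) vi; rewrite !mxE => -> ->; rewrite mulr0 addr0.
Qed.

Lemma FixN2_step_le0 w i : FixN2 A b c eta v w -> i \in idxN2 A v -> step w i 0 <= 0.
Proof.
move=> [/= hw hN2] iN2.
have := congr1 usubmx hw; rewrite pdhg_auxE col_mxKu => /matrixP /(_ i 0).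
rewrite primal_auxE (hN2 i iN2).
case: ifP => [|_ E]; first by move/idxB_notin_N2; rewrite iN2.
by rewrite -E le_max lexx orbT.
Qed.

Lemma FixN2D w t : FixN2 A b c eta v w -> 0 <= t -> FixN2 A b c eta v (w + t *: v).
Proof.
move=> hw t0; split; last by apply: zeroN2D; case: hw.
rewrite /= pdhg_auxE.
have E : primal_aux (w + t *: v) = primal_aux w + t *: vx.
  apply/matrixP => i j; rewrite (ord1 j) {j} [RHS]mxE [(t *: vx) i 0]mxE !primal_auxE.
  have -> : step (w + t *: v) i 0 = step w i 0 + t * grad v i 0.
    by rewrite primal_stepD primal_gradZ !mxE.
  case: (drift_index_cases i) => [[-> ->]|[/negbTE -> [_ [-> ->]]]|[/negbTE -> [iN2 [-> gi]]]].
  - by rewrite addrAC.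
  - by rewrite !mulr0 !addr0.
  - have h1 := FixN2_step_le0 hw iN2.
    have h2 : t * grad v i 0 <= 0 by rewrite mulr_ge0_le0 // ltW.
    rewrite mulr0 addr0; move/max_idPl: (h1) => ->; apply/max_idPl; lra.
rewrite E dual_stepD addrAC -add_col_mx -pdhg_auxE col_mx_drift.
by case: hw => /= ->.
Qed.

(** Such a point can miss Z*_v only through a negative forward step on B, and that step becomes
    nonnegative far along v. *)
Lemma FixN2_eventually_Zstar w : FixN2 A b c eta v w ->
  exists2 t, 0 <= t & Zstar A b c eta v (w + t *: v).
Proof.
move=> hw.
have [i|t t0 /(_ t (lexx _)) ht] := @eventually_forall_ord _ _
    (fun i s => i \in idxB v -> 0 <= step (w + s *: v) i 0).
  have hs s : step (w + s *: v) i 0 = step w i 0 + s * grad v i 0.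
    by rewrite primal_stepD primal_gradZ !mxE.
  case: (drift_index_cases i) => [[iB gi]|[/negbTE -> _]|[/negbTE -> _]]; [|by exists 0 ..].
  have [|s0 s0_ge0 h] := @eventually_affine_ge0 _ (step w i 0) (grad v i 0).
    by rewrite gi; move: iB; rewrite inE.
  by exists s0 => // s /h h' _; rewrite hs.
have hF := FixN2D hw t0.
have hact : active (w + t *: v).
  by move=> i; split=> [iB|iN2]; [exact: ht | exact: FixN2_step_le0 hF iN2].
exists t => //; rewrite /Zstar /=.
by rewrite addrAC -(pdhg_aux_active hact); case: hF => /= -> _; rewrite subrr.
Qed.

Lemma active_all : (forall i, i \in idxB v = false /\ i \in idxN2 A v = false) ->
  forall z, active z.
Proof. by move=> h z i; case: (h i) => -> ->. Qed.

End DriftStructure.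

(** * Consequences of minimality of v, and residual rates for PDHG *)

Section Displacement.
Variables (R : realType) (m d : nat) (A : 'M[R]_(m, d)) (b : 'cV[R]_m)
  (c : 'cV[R]_d) (eta : R) (v : 'cV[R]_(d + m)).
Hypotheses (eta_gt0 : 0 < eta) (eta_le : eta <= 1 / (2 * spectral_norm A))
  (v_inf : is_inf_displacement A b c eta v).
Local Notation T := (pdhg A b c eta).
Local Notation vx := (usubmx v).
Local Notation vy := (dsubmx v).
Local Notation step := (primal_step A c eta).
Local Notation grad := (primal_grad A eta).
Local Notation nrm := (normP A eta).
Local Notation Zs := (Zstar A b c eta v).
Local Notation W := (FixN2 A b c eta v).
Local Notation act := (active A c eta v).
Local Notation F := (resid T v).

Let P_inner : inner_product (dotP A eta) := dotP_inner eta_gt0 eta_le.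
Let T_firm := pdhg_firm A b c eta_gt0.

Lemma ZstarE z : Zs z <-> T z = z + v.
Proof.
rewrite /Zstar /=; split=> [/eqP|->]; last by rewrite [z + v]addrC addrK subrr.
by rewrite subr_eq0 subr_eq addrC => /eqP.
Qed.

Lemma Zstar_nonempty : exists z, Zs z.
Proof. by case: v_inf => [[z _ <-] _]; exists z; rewrite /Zstar /= subrr. Qed.

(** Minimality yields integer multiples of v only; real ones come in [Zstar_drift], from the
    structure deduced from this orbit. *)
Lemma Zstar_orbit z (n : nat) : Zs z -> T (z + n%:R *: v) = z + (n%:R + 1) *: v.
Proof.
move=> /ZstarE hz; elim: n => [|n IHn].
  by rewrite scale0r addr0 add0r scale1r.
have scale1 (x : R) : (x + 1) *: v = x *: v + v by rewrite scalerDl scale1r.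
move: IHn; rewrite -natr1 !scale1 !addrA => IHn.
apply: (min_displacement_translate P_inner T_firm) => // u.
by rewrite -!normPE; case: v_inf => _; apply; exists u.
Qed.

Lemma inf_displacement_conditions : drift_conditions A v.
Proof.
case: Zstar_nonempty => z hz.
by case: (drift_orbit_structure eta_gt0 (fun n => Zstar_orbit n hz)).
Qed.

Let v_drift := inf_displacement_conditions.

Lemma Zstar_coord z i : Zs z -> Num.max 0 (step z i 0) = usubmx z i 0 + vx i 0.
Proof.
move=> /ZstarE /(congr1 usubmx); rewrite pdhgE col_mxKu usubmxD.
by move/matrixP/(_ i 0); rewrite /proj_nonneg !mxE.
Qed.

Lemma Zstar_structure z : Zs z -> act z /\ W z.
Proof.
move=> hz.
have [_ [hB hN2]] := drift_orbit_structure eta_gt0 (fun n => Zstar_orbit n hz).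
have z0 i : i \in idxN2 A v -> usubmx z i 0 = 0.
  by rewrite inE => /andP[/eqP v0 g]; apply: hN2.
have hact : act z.
  move=> i; split=> [|iN2].
    by rewrite inE => /hB ->; rewrite -Zstar_coord // le_max lexx.
  have := Zstar_coord i hz; rewrite z0 //.
  by move: iN2; rewrite inE => /andP[/eqP -> _] /eqP; rewrite addr0 eq_maxl.
split=> //; split=> //=.
by rewrite (pdhg_aux_active _ eta_gt0) //; move/ZstarE: hz => ->; rewrite addrK.
Qed.

Lemma Zstar_drift z t : Zs z -> 0 <= t -> T (z + t *: v) = z + (t + 1) *: v.
Proof.
move=> hz t0; case: (Zstar_structure hz) => hact _.
rewrite (pdhg_translate _ eta_gt0) //; move/ZstarE: hz => ->.
by rewrite scalerDl scale1r -addrA [v + _]addrC.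
Qed.

Lemma ZstarD z t : Zs z -> 0 <= t -> Zs (z + t *: v).
Proof. by move=> hz t0; apply/ZstarE; rewrite Zstar_drift // scalerDl scale1r addrA. Qed.

(** If v = 0, a point of Z*_v is a fixed point of T, and its two blocks are feasible for the primal
    and for the dual. *)
Lemma inf_displacement_neq0 : lp_infeasible A b c -> v != 0.
Proof.
move=> hinf; apply/negP => /eqP v0.
case: Zstar_nonempty => z hz.
have hx i : Num.max 0 (step z i 0) = usubmx z i 0.
  by rewrite (Zstar_coord i hz) (_ : vx i 0 = 0) ?addr0 // v0 !mxE.
case: hinf; apply.
- exists (usubmx z); split=> [i|]; first by rewrite -hx le_max lexx.
  move/ZstarE: hz; rewrite v0 addr0 => /(congr1 dsubmx).
  rewrite pdhgE col_mxKd /dual_step.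
  have -> : proj_nonneg (step z) = usubmx z.
    by apply/matrixP => i j; rewrite (ord1 j) -hx mxE.
  rewrite -[2]/(1 + 1) scalerDl scale1r addrK -addrA -[RHS]addr0 => /addrI.
  rewrite -scalerBr => /eqP; rewrite scaler_eq0 gt_eqF //= subr_eq0.
  by move/eqP.
- exists (dsubmx z) => i.
  have := hx i; have : step z i 0 <= Num.max 0 (step z i 0) by rewrite le_max lexx orbT.
  have -> : step z i 0 = usubmx z i 0 - eta * (c + A^T *m dsubmx z) i 0.
    by rewrite /primal_step /primal_grad !mxE; ring.
  by move=> /[swap] ->; rewrite gerBl pmulr_rge0.
Qed.

Lemma norm2_usubmx p q (z : 'cV[R]_(p + q)) : norm2 (usubmx z) <= norm2 z.
Proof.
rewrite ler_sqrt; last by apply: sumr_ge0 => i _; exact: sqr_ge0.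
rewrite big_split_ord /=.
have -> : \sum_i usubmx z i 0 ^+ 2 = \sum_i z (lshift q i) 0 ^+ 2.
  by apply: eq_bigr => i _; rewrite mxE.
by rewrite lerDl sumr_ge0 // => i _; exact: sqr_ge0.
Qed.

Lemma norm2_dsubmx p q (z : 'cV[R]_(p + q)) : norm2 (dsubmx z) <= norm2 z.
Proof.
rewrite ler_sqrt; last by apply: sumr_ge0 => i _; exact: sqr_ge0.
rewrite big_split_ord /=.
have -> : \sum_i dsubmx z i 0 ^+ 2 = \sum_i z (rshift p i) 0 ^+ 2.
  by apply: eq_bigr => i _; rewrite mxE.
by rewrite lerDr sumr_ge0 // => i _; exact: sqr_ge0.
Qed.

Lemma primal_grad_bound : exists2 L, 0 <= L &
  forall z i, `|grad z i 0| <= L * nrm z.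
Proof.
have s0 : 0 <= spectral_norm A^T.
  have := ub_le_sup (spectral_norm_bounded A^T); apply.
  exists 0; rewrite ?mulmx0 /= norm2E /ipnorm (ip0l dot_inner) sqrtr0 //.
exists ((1 + eta * spectral_norm A^T) * Num.sqrt (2 * eta)) => [|z i].
  by rewrite mulr_ge0 ?sqrtr_ge0 // addr_ge0 // mulr_ge0 // ltW.
rewrite -mulrA; apply: (@le_trans _ _ ((1 + eta * spectral_norm A^T) * norm2 z)); last first.
  rewrite ler_wpM2l ?norm2_le_normP //.
  by rewrite addr_ge0 // mulr_ge0 // ltW.
rewrite mulrDl mul1r -mulrA.
have -> : grad z i 0 = usubmx z i 0 - eta * (A^T *m dsubmx z) i 0 by rewrite !mxE.
apply: le_trans (ler_normB _ _) _; rewrite lerD //.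
  exact: le_trans (ler_abs_norm2 _ _) (norm2_usubmx _).
rewrite normrM gtr0_norm // ler_pM2l //.
apply: le_trans (ler_abs_norm2 _ _) _; apply: le_trans (norm2_mulmx _ _) _.
by rewrite ler_wpM2l // norm2_dsubmx.
Qed.

(** Moving by at most r in the P-norm changes each forward step by at most [L * r]; far along the
    ray the margins on B and N_2 exceed this. *)
Lemma eventually_active z r : Zs z -> exists2 s0, 0 <= s0 &
  forall s, s0 <= s -> forall w, nrm (w - (z + s *: v)) <= r -> act w.
Proof.
move=> hz; have [L L0 hL] := primal_grad_bound.
have [hact _] := Zstar_structure hz.
have [i|s0 s0_ge0 hs] := @eventually_forall_ord R d
  (fun i s => (i \in idxB v -> L * r <= step z i 0 + s * grad v i 0) /\
     (i \in idxN2 A v -> step z i 0 + s * grad v i 0 <= - (L * r))).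
  case: (drift_index_cases eta_gt0 v_drift i)
      => [[iB gi]|[/negbTE -> [iN1 [v0 gi]]]|[/negbTE -> [iN2 [v0 gi]]]].
  - have [|s0 s0_ge0 h] := @eventually_affine_ge0 _ (step z i 0 - L * r) (grad v i 0).
      by rewrite gi; move: iB; rewrite inE.
    exists s0 => // s /h hs; rewrite (idxB_notin_N2 A iB); split=> // _; lra.
  - exists 0 => // s _; split=> // iN2.
    by move: iN1 iN2; rewrite !inE => /andP[_ /eqP ->]; rewrite ltxx andbF.
  - have [|s0 s0_ge0 h] := @eventually_affine_ge0 _ (- step z i 0 - L * r) (- grad v i 0).
      by rewrite oppr_gt0.
    by exists s0 => // s /h hs; split=> // _; lra.
exists s0 => // s /hs h w hw i.
have E : step w i 0 = (step z i 0 + s * grad v i 0) + grad (w - (z + s *: v)) i 0.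
  rewrite -{1}[w](subrK (z + s *: v)) addrC !primal_stepD primal_gradZ.
  by move: (grad _) (step z) => g1 s1; rewrite !mxE.
have := hL (w - (z + s *: v)) i; have := ler_wpM2l L0 hw.
rewrite E; move: (grad (w - _) i 0) => g h1 h2.
have := ler_norm g; have := ler_norm (- g); rewrite normrN => h3 h4.
by case: (h i) => hB hN2; split=> [/hB|/hN2] h5; lra.
Qed.

(** Both points are shifted by t v until the second lies in Z*_v, where the residual is 0; the
    residual of [y] and the difference [y - w] do not change. *)
Lemma resid_active_monotone y w : act y -> W w ->
  0 <= dotP A eta (F y) (y - w) /\ nrm (F y) <= nrm (y - w).
Proof.
move=> hy /(FixN2_eventually_Zstar eta_gt0 v_drift) [t t0] /ZstarE hw.
have Fy : F (y + t *: v) - F (w + t *: v) = F y.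
  rewrite /resid hw (pdhg_translate _ eta_gt0) //.
  by apply/matrixP => i j; rewrite !mxE; ring.
have dE : (y + t *: v) - (w + t *: v) = y - w.
  by apply/matrixP => i j; rewrite !mxE; ring.
have := resid_cocoercive P_inner v T_firm (y + t *: v) (w + t *: v).
have := resid_le P_inner v T_firm (y + t *: v) (w + t *: v).
rewrite Fy dE => h1 h2; split=> //.
exact: le_trans (ip_ge0 P_inner _) h2.
Qed.

(** Since T (y + v) = T y + v, this is nonexpansiveness for the pair y + v, T y. *)
Lemma resid_pdhg_le y : act y -> nrm (F (T y)) <= nrm (F y).
Proof.
move=> hy; have := firm_nonexpansive P_inner T_firm (y + v) (T y).
have -> : T (y + v) = T y + v.
  by have := pdhg_translate b eta_gt0 v_drift hy ler01; rewrite scale1r.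
by rewrite -!normPE /resid (addrAC (T y) v) (addrAC y v).
Qed.

(** With every iterate active the potential starts at 0 and stays <= 0, so [halpern_rate] applies
    with M = 0. *)
Lemma epoch_rate z w K : (0 < K)%N ->
  (forall k, act (halpern T z k)) -> W w ->
  K%:R * nrm (F (halpern T z K)) <= 2 * nrm (z - w).
Proof.
move=> K0 hact hw.
have pot k : potential (dotP A eta) T v z k <= 0.
  elim: k => [|k IHk].
    by rewrite /potential /= !mul0r scale0r subr0 subrr (ipC P_inner) (ip0l P_inner) mulr0 addr0.
  apply: le_trans IHk; apply: (potential_step P_inner T_firm) => t t0.
  by rewrite (pdhg_translate _ eta_gt0).
have := halpern_rate P_inner K0 (lexx 0) (pot K).
move=> /(_ w); rewrite mulr0 eqxx !addr0 !normPE; apply.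
have hW : W (w + (K%:R / 2) *: v) by apply: FixN2D => //; rewrite divr_ge0.
by case: (resid_active_monotone (hact K) hW).
Qed.

(** The potential is monotone only from [k0] on, and its value there is absorbed in G. As G does not
    depend on K, K can be chosen large against it. *)
Lemma late_active_rate z k0 : exists2 G, 0 <= G &
  forall K, (0 < K)%N -> (k0 <= K)%N ->
  (forall k, (k0 <= k)%N -> act (halpern T z k)) ->
  K%:R * nrm (F (halpern T z K)) <= G.
Proof.
have [w /Zstar_structure[_ hw]] := Zstar_nonempty.
set M := `|potential (dotP A eta) T v z k0|.
exists (2 * nrm (z - w) + (2 * M + (M != 0)%:R)).
  by rewrite !addr_ge0 ?mulr_ge0 ?ler0n ?normr_ge0 // sqrtr_ge0.
move=> K K_gt0 hK hact.
have pot k : (k0 <= k)%N -> potential (dotP A eta) T v z k <= M.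
  elim: k => [|k IHk].
    by rewrite leqn0 /M => /eqP ->; apply: ler_norm.
  rewrite leq_eqVlt => /orP[/eqP <-|]; first exact: ler_norm.
  rewrite ltnS => hk; apply: le_trans (IHk hk).
  apply: (potential_step P_inner T_firm) => t t0.
  by rewrite (pdhg_translate _ eta_gt0) //; apply: hact.
apply: (halpern_rate P_inner) => //; first exact: normr_ge0.
  exact: pot.
have hW : W (w + (K%:R / 2) *: v) by apply: FixN2D => //; rewrite divr_ge0.
by case: (resid_active_monotone (hact K hK) hW).
Qed.

End Displacement.

(** * The restart frequency *)

Section Distance.
Variables (R : realType) (m d : nat) (A : 'M[R]_(m, d)) (eta : R).
Implicit Types (z u : 'cV[R]_(d + m)) (U : set 'cV[R]_(d + m)).

Lemma distP_le z u U : U u -> distP A eta z U <= normP A eta (z - u).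
Proof.
move=> hu; apply: ge_inf; last by exists u.
by exists 0 => _ [w _ <-]; apply: sqrtr_ge0.
Qed.

Lemma distP_ge z U M : U !=set0 -> (forall u, U u -> M <= normP A eta (z - u)) ->
  M <= distP A eta z U.
Proof.
move=> [u hu] h; apply: lb_le_inf; first by exists (normP A eta (z - u)), u.
by move=> _ [w hw <-]; apply: h.
Qed.

End Distance.

Lemma radius_unbounded (R : realType) (n : nat) (z0 z v : 'cV[R]_n) (M : R) :
  v != 0 -> exists2 t, 0 <= t & M <= radius z0 (z + t *: v).
Proof.
move=> v0; have nv : 0 < norm2 v.
  rewrite lt_def norm2_ge0 andbT; apply: contra v0 => /eqP h.
  by apply/eqP/(ipnorm_eq0 dot_inner); rewrite -norm2E.
(* Then t |v| = |M| + |z|, so the new centre has norm at least |M|. *)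
exists ((`|M| + norm2 z) / norm2 v).
  by rewrite divr_ge0 ?addr_ge0 ?norm2_ge0.
set t := _ / _; set w := z + t *: v.
have t0 : 0 <= t by rewrite divr_ge0 ?addr_ge0 ?norm2_ge0.
have h : t * norm2 v <= norm2 w + norm2 z.
  have := ipnorm_triangle dot_inner w (- z).
  rewrite /w [z + _]addrC addrK (ipnormZ dot_inner) // (ipnormN dot_inner).
  by rewrite -!norm2E.
have := norm2_ge0 (z0 - w); have := norm2_ge0 w; have := ler_norm M.
have := normr_ge0 M; move: h; rewrite divfK ?gt_eqF // /radius; lra.
Qed.

Lemma delta_fin_gt0 (R : realType) (m d : nat) (A : 'M[R]_(m, d)) (v : 'cV[R]_(d + m)) i :
  0 < spectral_norm A -> (i \in idxB v) || (i \in idxN2 A v) ->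
  exists2 dl, 0 < dl & delta A v = dl%:E.
Proof.
move=> sA hi.
have pos : (0 < delta A v)%E.
  rewrite lt_min; apply/andP; split; apply/bigmin_gtP; split=> [|j]; rewrite ?ltry //.
    by rewrite inE lte_fin.
  by rewrite inE lte_fin => /andP[_ h]; rewrite divr_gt0.
have fin : (delta A v < +oo)%E.
  rewrite gt_min; case/orP: hi => hi; apply/orP; [left | right].
    by apply: le_lt_trans (bigmin_le_cond _ _ hi) _; rewrite ltry.
  by apply: le_lt_trans (bigmin_le_cond _ _ hi) _; rewrite ltry.
by case: (delta A v) pos fin => // r r0 _; exists r.
Qed.

Section Kstar.
Variables (R : realType) (rad C a : R).
Local Notation s := ((Num.sqrt 2 + 1) * expR 1 / a).

Let ceil_nat (x : R) : x <= `|Num.ceil x|%N%:R.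
Proof.
apply: le_trans (ceil_ge x) _.
by rewrite natr_absz ler_int ler_norm.
Qed.

Lemma kstar_ge_sln del : s * ln s <= (kstar rad C del a)%:R.
Proof.
by apply: le_trans (ceil_nat _); rewrite le_max lexx orbT.
Qed.

Lemma kstar_ge_radius dl : 0 < C -> 0 < dl ->
  12 * rad / (C * dl) <= (kstar rad C dl%:E a)%:R.
Proof.
move=> C0 dl0; apply: le_trans (ceil_nat _); rewrite le_max; apply/orP; left.
by rewrite -EFinM inver gt_eqF ?mulr_gt0 // -EFinM.
Qed.

Hypothesis a01 : 0 < a < 1.

Lemma sharp_scale_ge : expR 1 <= s.
Proof.
case/andP: a01 => a0 a1; rewrite ler_pdivlMr //.
have := sqrtr_ge0 (2 : R); have := expR_gt0 (1 : R); nra.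
Qed.

Lemma ln_sharp_scale_ge1 : 1 <= ln s.
Proof.
have e0 := expR_gt0 (1 : R).
rewrite -[leLHS](expRK 1) ler_ln ?posrE ?sharp_scale_ge //.
exact: lt_le_trans e0 sharp_scale_ge.
Qed.

Lemma kstar_ge_scale del : s <= (kstar rad C del a)%:R.
Proof.
apply: le_trans (kstar_ge_sln del); rewrite ler_peMr ?ln_sharp_scale_ge1 //.
exact: le_trans (expR_ge0 _) sharp_scale_ge.
Qed.

(* s ln s suffices when s >= e^L, and L e^L when s < e^L. *)
Lemma kstar_ge_mul del L : 0 <= L -> L * expR L <= (kstar rad C del a)%:R ->
  L * s <= (kstar rad C del a)%:R.
Proof.
move=> L0 hK.
have s0 : 0 < s := lt_le_trans (expR_gt0 _) sharp_scale_ge.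
have [h|h] := leP (expR L) s; last first.
  by apply: le_trans hK; rewrite ler_wpM2l // ltW.
apply: le_trans (kstar_ge_sln del); rewrite mulrC ler_wpM2l ?(ltW s0) //.
by rewrite -[leLHS](expRK L) ler_ln ?posrE ?expR_gt0.
Qed.

End Kstar.

(** * Linear convergence *)

Section Epochs.
Variables (R : realType) (m d : nat) (A : 'M[R]_(m, d)) (b : 'cV[R]_m)
  (c : 'cV[R]_d) (eta : R) (v : 'cV[R]_(d + m)).
Hypotheses (eta_gt0 : 0 < eta) (eta_le : eta <= 1 / (2 * spectral_norm A))
  (v_inf : is_inf_displacement A b c eta v).
Local Notation T := (pdhg A b c eta).
Local Notation nrm := (normP A eta).
Local Notation Zs := (Zstar A b c eta v).
Local Notation W := (FixN2 A b c eta v).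
Local Notation act := (active A c eta v).
Local Notation F := (resid T v).

Let P_inner : inner_product (dotP A eta) := dotP_inner eta_gt0 eta_le.
Let T_firm := pdhg_firm A b c eta_gt0.
Let v_drift := inf_displacement_conditions eta_gt0 eta_le v_inf.

Lemma normP_displacement z : nrm (T z - z - v) = nrm (F z).
Proof. by rewrite normPE -(ipnormN P_inner) /resid !opprD !opprK [- T z + z]addrC. Qed.

Lemma FixN2_nonempty : W !=set0.
Proof.
have [z hz] := Zstar_nonempty v_inf.
by exists z; case: (Zstar_structure eta_gt0 eta_le v_inf hz).
Qed.

Lemma epoch_near_drift zs K z n k : Zs zs ->
  nrm (halpern T (restarted_halpern T K z n) k
       - (zs + (n%:R * (K%:R / 2 + 1) + k%:R / 2) *: v)) <= nrm (z - zs).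
Proof.
move=> hz; have drift t : 0 <= t -> T (zs + t *: v) = zs + (t + 1) *: v.
  exact: Zstar_drift.
apply: le_trans (restarted_near_drift P_inner T_firm K z n drift).
set s := n%:R * _; have s0 : 0 <= s by rewrite mulr_ge0 ?addr_ge0 ?divr_ge0.
rewrite scalerDl addrA; apply: (halpern_near_drift P_inner T_firm) => t t0.
by rewrite -!addrA -!scalerDl drift ?addr_ge0 // addrA.
Qed.

(** Restart points keep their distance to the ray through any zs in Z*_v; the residual is
    1-Lipschitz and zero on that ray. *)
Lemma resid_restarted_le K z n :
  nrm (F (restarted_halpern T K z n)) <= distP A eta z Zs.
Proof.
apply: distP_ge => [|zs hz]; first exact: (Zstar_nonempty v_inf).
apply: le_trans (epoch_near_drift K z n 0 hz); rewrite /= mul0r addr0.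
set t := n%:R * _; have t0 : 0 <= t by rewrite mulr_ge0 ?addr_ge0 ?divr_ge0.
have hzt : Zs (zs + t *: v) by apply: ZstarD.
have [hact hW] := Zstar_structure eta_gt0 eta_le v_inf hzt.
set y := restarted_halpern T K z n.
have := resid_le P_inner v T_firm y (zs + t *: v).
have -> : F (zs + t *: v) = 0.
  by move/ZstarE: hzt => E; rewrite /resid E opprD addrA subrr sub0r addNr.
by rewrite subr0 -!normPE.
Qed.

Lemma resid_le_distP y : act y -> nrm (F y) <= distP A eta y W.
Proof.
move=> hy; apply: distP_ge => [|w hw]; first exact: FixN2_nonempty.
by case: (resid_active_monotone eta_gt0 eta_le v_inf hy hw).
Qed.

(* The sharpness inequality is only available on a ball, which the iterates
   leave along v; it is applied to y - t v instead of y. *)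
Lemma sharp_along_drift z0 zt a y t :
  is_sharpness_constant A b c eta v z0 zt a -> 0 <= t ->
  act (y - t *: v) -> zeroN2 A v y -> norm2 (y - t *: v) <= radius z0 zt ->
  a * distP A eta y W <= nrm (F y).
Proof.
move=> [/andP[a0 _] _ sharp] t0 hact hN2 hrad.
set y' := y - t *: v in hact hrad.
have yE : y = y' + t *: v by rewrite /y' subrK.
have hN2' : zeroN2 A v y' by rewrite /y' -scaleNr; apply: zeroN2D.
have := sharp y' hN2' hrad.
rewrite (pdhg_aux_active b eta_gt0 v_drift hact) -addrA [- v - y']addrC addrA.
rewrite normP_displacement.
have -> : F y = F y'.
  rewrite yE /resid (pdhg_translate b eta_gt0 v_drift hact t0).
  by apply/matrixP => i j; rewrite !mxE; ring.
apply: le_trans; rewrite ler_pM2l //.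
apply: distP_ge => [|w hw]; first exact: FixN2_nonempty.
(* Forward translation preserves W, so y is no farther from W than [y']. *)
have hw' : W (w + t *: v) by apply: FixN2D.
have := distP_le A eta y hw'.
by rewrite yE opprD addrACA subrr addr0.
Qed.

End Epochs.

(** * Choice of the centre, and induction over the epochs *)

Theorem theorem5 (R : realType) (m d : nat) (A : 'M[R]_(m, d))
    (b : 'cV[R]_m) (c : 'cV[R]_d) (eta C : R) (v z0 : 'cV[R]_(d + m))
    (hA : A != 0)
    (hinf : lp_infeasible A b c)
    (heta0 : 0 < eta)
    (heta : eta <= 1 / (2 * spectral_norm A))
    (hv : is_inf_displacement A b c eta v)
    (hC0 : 0 < C)
    (hC : C <= Num.min (1 / (Num.sqrt 2 * (1 + eta * spectral_norm A)))
                       (eta / (Num.sqrt 2 * (1 + eta * spectral_norm A)))) :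
  exists zt : 'cV[R]_(d + m),
    [/\ Zstar A b c eta v zt,
        FixN2 A b c eta v zt &
        forall a : R, is_sharpness_constant A b c eta v z0 zt a ->
        forall n : nat,
          let T := pdhg A b c eta in
          let K := kstar (radius z0 zt) C (delta A v) a in
          let zn := restarted_halpern T K z0 n in
          normP A eta (T zn - zn - v)
            <= 2 * expR (- n%:R) * distP A eta z0 (Zstar A b c eta v)].
Proof.
have [zs hzs] := Zstar_nonempty hv.
set r := normP A eta (z0 - zs).
set nondeg := [forall i, (i \notin idxB v) && (i \notin idxN2 A v)].
have act_nondeg : nondeg -> forall z, active A c eta v z.
  move=> /forallP h; apply: active_all => i.
  by have /andP[/negbTE -> /negbTE ->] := h i.
(* Beyond parameter s0 on the ray the whole r-neighbourhood is active; s0 = 0 when B and N_2 are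
   empty, so that the first epoch already contracts. *)
have [s0 [s0_ge0 s0_act s0_nondeg]] : exists s0, [/\ 0 <= s0,
    forall s, s0 <= s -> forall w, normP A eta (w - (zs + s *: v)) <= r ->
      active A c eta v w & nondeg -> s0 = 0].
  have [hd|hd] := boolP nondeg.
    by exists 0; split=> // s _ w _; apply: act_nondeg.
  have [s s_ge0 h] := eventually_active heta0 heta hv r hzs.
  by exists s; split.
(* In the first epoch, iterate k lies near ray parameter k/2. The constant G obtained from k0 is
   fixed before the centre, hence before K. *)
set k0 := Num.bound (2 * s0).
have k0_ge : 2 * s0 <= k0%:R by apply/ltW/archi_boundP; rewrite mulr_ge0.
have [G G_ge0 hG] := late_active_rate heta0 heta hv z0 k0.
set D0 := distP A eta z0 (Zstar A b c eta v).
have D0_ge0 : 0 <= D0 by apply: distP_ge => [|u _]; [exists zs | exact: sqrtr_ge0].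
set L := G / D0; have L_ge0 : 0 <= L by rewrite divr_ge0.
(* A lower bound wanted for K: L e^L serves [kstar_ge_mul], and k0 ends the transient within the
   first epoch. *)
set X := L * expR L + k0%:R + 1.
set del := fine (delta A v).
(* Bounds the Euclidean norm of every point within P-distance r of zs + s0 v. The other bound, X C
   delta / 12, makes the first term of [kstar] at least X when delta is finite. *)
set rad0 := Num.sqrt (2 * eta) * r + norm2 (zs + s0 *: v).
have [t t0 ht] := @radius_unbounded _ _ z0 zs v (Num.max rad0 (X * (C * del) / 12))
  (inf_displacement_neq0 heta0 hv hinf).
move: ht; rewrite ge_max => /andP[ht_rad ht_X].
exists (zs + t *: v).
have hzt : Zstar A b c eta v (zs + t *: v) by apply: ZstarD.
have [_ hzt'] := Zstar_structure heta0 heta hv hzt.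
split=> // a sharp.
set T := pdhg A b c eta; set K := kstar _ _ _ _.
set zn := restarted_halpern T K z0.
set W := FixN2 A b c eta v.
move=> n /=; rewrite normP_displacement //.
have a01 : 0 < a < 1 by case: sharp.
have /andP[a0 _] := a01.
set s := (Num.sqrt 2 + 1) * expR 1 / a.
have s_ge : expR 1 <= s by apply: sharp_scale_ge.
have s_gt0 : 0 < s := lt_le_trans (expR_gt0 _) s_ge.
have K_ge : s <= K%:R by apply: kstar_ge_scale.
have K_gt0 : (0 < K)%N by rewrite -(ltr_nat R) (lt_le_trans s_gt0).
have K_gt0R : 0 < K%:R :> R by rewrite ltr0n.
have sqrt2 : 1 <= Num.sqrt 2 :> R by rewrite -[leLHS]sqrtr1 ler_sqrt // ler1n.
have e_gt0 : 0 < expR 1 :> R := expR_gt0 1.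
(* Here a s = (sqrt 2 + 1) e >= 2 e; the 2 absorbs the constant of [epoch_rate]. *)
have aK : 2 * expR 1 <= a * K%:R.
  apply: le_trans (_ : a * s <= _); last by rewrite ler_pM2l.
  by rewrite /s [leRHS]mulrC divfK ?gt_eqF // ler_pM2r //; lra.
have K_ge_X : ~~ nondeg -> X <= K%:R.
  rewrite negb_forall => /existsP[i]; rewrite negb_and !negbK => hi.
  have [dl dl0 dlE] := delta_fin_gt0 (spectral_norm_gt0 heta0 heta) hi.
  rewrite /K dlE; apply: le_trans (kstar_ge_radius _ _ hC0 dl0).
  rewrite ler_pdivlMr ?mulr_gt0 //.
  by move: ht_X; rewrite /del dlE /=; lra.
have K_ge_s0 : s0 <= K%:R / 2 + 1.
  have [/s0_nondeg ->|/K_ge_X hX] := boolP nondeg.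
    by rewrite addr_ge0 // divr_ge0.
  have := mulr_ge0 L_ge0 (expR_ge0 L); move: hX; rewrite /X; lra.
(* The ray parameter of the j-th restart point; it is at least s0 for j >= 1. *)
set sg := fun j : nat => j%:R * (K%:R / 2 + 1) : R.
have sgS j : s0 <= sg j.+1.
  rewrite /sg -natr1 mulrDl mul1r (le_trans K_ge_s0) // lerDr.
  by rewrite mulr_ge0 ?addr_ge0 ?divr_ge0.
have near j k : normP A eta (halpern T (zn j) k - (zs + (sg j + k%:R / 2) *: v)) <= r.
  exact: epoch_near_drift.
have act_k j k : s0 <= sg j + k%:R / 2 -> active A c eta v (halpern T (zn j) k).
  by move=> h; apply: s0_act h _ (near j k).
have sharp_step j : active A c eta v (halpern T (zn j) K) ->
    a * distP A eta (zn j.+1) W <= normP A eta (resid T v (halpern T (zn j) K)).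
  move=> hact; apply: (@le_trans _ _ (normP A eta (resid T v (zn j.+1)))); last first.
    exact: resid_pdhg_le.
  (* The restart point is pulled back along v to parameter s0, where it is still active and lies in
     the sharpness ball. *)
  have hnear : normP A eta (zn j.+1 - (sg j.+1 - s0) *: v - (zs + s0 *: v)) <= r.
    have := near j.+1 0%N; rewrite mul0r addr0 /= -/(zn j.+1).
    congr (normP A eta _ <= r).
    by apply/matrixP => i1 i2; rewrite !mxE; ring.
  apply: (sharp_along_drift heta0 heta hv (t := sg j.+1 - s0)) sharp _ _ _ _.
  - by rewrite subr_ge0.
  - exact: s0_act (lexx _) _ hnear.
  - exact: zeroN2_pdhg.
  - apply: le_trans ht_rad.
    set y := zn j.+1 - _ in hnear *.
    have := ipnorm_triangle dot_inner (y - (zs + s0 *: v)) (zs + s0 *: v).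
    rewrite subrK -!norm2E => /le_trans; apply; rewrite lerD2r.
    apply: le_trans (norm2_le_normP heta0 heta _) _.
    by rewrite ler_wpM2l ?sqrtr_ge0.
have contract j : s0 <= sg j -> distP A eta (zn j.+1) W <= expR (-1) * distP A eta (zn j) W.
  move=> hj; have hact k : active A c eta v (halpern T (zn j) k).
    by apply: act_k; rewrite (le_trans hj) // lerDl divr_ge0.
  have h1 : K%:R * (a * distP A eta (zn j.+1) W) <= 2 * distP A eta (zn j) W.
    rewrite [leRHS]mulrC -ler_pdivrMr //.
    apply: distP_ge => [|w hw]; first by apply: FixN2_nonempty.
    rewrite ler_pdivrMr // [leRHS]mulrC.
    apply: le_trans (epoch_rate heta0 heta hv K_gt0 hact hw).
    by rewrite ler_wpM2l // sharp_step.
  rewrite expRN ler_pdivlMl //.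
  have : 2 * expR 1 * distP A eta (zn j.+1) W <= a * K%:R * distP A eta (zn j.+1) W.
    apply: ler_wpM2r aK; apply: distP_ge => [|w _]; [exact: FixN2_nonempty | exact: sqrtr_ge0].
  lra.
(* The induction runs on the distance to W; it starts at n0 = 0 without a transient, and at n0 = 1
   otherwise. *)
have decay n0 : (forall j, (n0 <= j)%N -> s0 <= sg j) ->
    distP A eta (zn n0) W <= 2 * expR (- n0%:R) * D0 ->
    forall j, (n0 <= j)%N -> normP A eta (resid T v (zn j)) <= 2 * expR (- j%:R) * D0.
  move=> hs hbase j hj.
  have hact : active A c eta v (zn j).
    by apply: (act_k j 0%N); rewrite mul0r addr0 hs.
  apply: le_trans (resid_le_distP heta0 heta hv hact) _.
  elim: j hj {hact} => [|j IHj].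
    by rewrite leqn0 => /eqP n00; move: hbase; rewrite n00.
  rewrite leq_eqVlt => /orP[/eqP <- //|]; rewrite ltnS => hj.
  apply: le_trans (contract j (hs j hj)) _.
  have -> : expR (- j.+1%:R) = expR (-1) * expR (- j%:R) :> R.
    by rewrite -expRD -natr1 opprD addrC.
  have := ler_wpM2l (expR_ge0 (-1)) (IHj hj); lra.
have [hnd|hnd] := boolP nondeg.
  apply: (decay 0%N) => // [j _|].
    by rewrite s0_nondeg // mulr_ge0 // addr_ge0 // divr_ge0.
  rewrite oppr0 expR0 mulr1; apply: (@le_trans _ _ D0); last by lra.
  apply: distP_ge => [|u hu]; first by exists zs.
  by apply: distP_le; case: (Zstar_structure heta0 heta hv hu).
have [n_eq0|n_gt0] := posnP n.
  apply: le_trans (resid_restarted_le heta0 heta hv K z0 n) _.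
  by rewrite n_eq0 oppr0 expR0 mulr1 -/D0; lra.
(* Separated because L = G / D0 takes the default value 0 here. *)
have [D0_eq0|D0_neq0] := eqVneq D0 0.
  apply: le_trans (resid_restarted_le heta0 heta hv K z0 n) _.
  by rewrite -/D0 D0_eq0 mulr0.
have D0_gt0 : 0 < D0 by rewrite lt_def D0_neq0.
apply: (decay 1%N) => // [[|j]//|].
have k0K : (k0 <= K)%N.
  rewrite -(ler_nat R) (le_trans _ (K_ge_X hnd)) // /X.
  have := mulr_ge0 L_ge0 (expR_ge0 L); lra.
have hact k : (k0 <= k)%N -> active A c eta v (halpern T z0 k).
  rewrite -(ler_nat R) => hk; apply: (act_k 0%N); rewrite /sg mul0r add0r.
  by rewrite ler_pdivlMr // mulrC (le_trans k0_ge).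
have h1 := hG K K_gt0 k0K hact.
have h2 := sharp_step 0%N (hact K k0K).
have h3 : L * s <= K%:R.
  apply: kstar_ge_mul => //; apply: le_trans (K_ge_X hnd); rewrite /X.
  by rewrite -addrA lerDl addr_ge0.
have GE : G = L * D0 by rewrite /L divfK.
set D1 := distP A eta (zn 1%N) W in h2 *.
have h4 : K%:R * (a * D1) <= L * D0.
  by rewrite -GE; apply: le_trans h1; rewrite ler_pM2l.
have D1_ge0 : 0 <= D1.
  by apply: distP_ge => [|w _]; [exact: FixN2_nonempty | exact: sqrtr_ge0].
suff h5 : expR 1 * D1 <= D0.
  rewrite expRN -mulrA mulrCA ler_pdivlMl //.
  by apply: le_trans h5 _; lra.
(* If L = 0 then D1 = 0; otherwise L is cancelled below and a s >= e concludes. *)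
have [L0|L_neq0] := eqVneq L 0.
  have D1_le0 : D1 <= 0.
    by move: h4; rewrite L0 mul0r pmulr_rle0 // pmulr_rle0.
  by apply: le_trans D0_ge0; rewrite pmulr_rle0.
have L_gt0 : 0 < L by rewrite lt_def L_neq0.
have h6 : L * (a * s * D1) <= L * D0.
  apply: le_trans h4.
  have -> : L * (a * s * D1) = L * s * (a * D1) by ring.
  by rewrite ler_wpM2r // mulr_ge0 // ltW.
move: h6; rewrite ler_pM2l // /s [a * _]mulrC divfK ?gt_eqF // => h6.
have := mulr_ge0 (ltW e_gt0) D1_ge0; nra.
Qed.
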